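(* Let $(M^{2n+1},\phi,\xi,\eta,g,\nabla,\nabla^{*})$ be an almost cosymplectic statistical manifold with difference tensor $\mathcal{K}$, and let $\mathcal{A}X=-\nabla_{X}\xi$, $\mathcal{A}^{*}X=-\nabla^{*}_{X}\xi$. Assume that $\mathcal{K}_{\xi}\phi=0$ and $\mathcal{A}\xi=0$. Then, for every vector field $X$ on $M$, $$R(X,\xi)\xi-\phi R(\phi X,\xi)\xi+R^{*}(X,\xi)\xi-\phi R^{*}(\phi X,\xi)\xi=-2\big(\mathcal{A}^{2}+(\mathcal{A}^{*})^{2}\big)X,$$ and $$S(\xi,\xi)+S^{*}(\xi,\xi)=-\operatorname{tr}\big(\mathcal{A}^{2}+(\mathcal{A}^{*})^{2}\big).$$
   Context: A statistical manifold $(M,g,\nabla,\nabla^{*})$ is a Riemannian manifold $(M,g)$ with torsion-free affine connections $\nabla,\nabla^{*}$ satisfying $Zg(X,Y)=g(\nabla_{Z}X,Y)+g(X,\nabla^{*}_{Z}Y)$ for all vector fields $X,Y,Z$. Its difference tensor is $\mathcal{K}_{X}Y=\nabla_{X}Y-\nabla^{0}_{X}Y$, with $\nabla^{0}$ the Levi-Civita connection of $g$. Here $\mathcal{K}_{\xi}\phi$ is the $(1,1)$-tensor field $(\mathcal{K}_{\xi}\phi)X=\mathcal{K}_{\xi}\phi X-\phi\mathcal{K}_{\xi}X$. An almost contact metric manifold $(M^{2n+1},\phi,\xi,\eta,g)$ has a $(1,1)$-tensor field $\phi$, a vector field $\xi$, a 1-form $\eta$ and a Riemannian metric $g$ with $\phi^{2}=-\mathrm{Id}+\eta\otimes\xi$,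 $\eta(\xi)=1$, $g(\phi X,\phi Y)=g(X,Y)-\eta(X)\eta(Y)$. Its fundamental form is $\Phi(X,Y)=g(\phi X,Y)$. It is almost cosymplectic if $d\eta=0$ and $d\Phi=0$. An almost cosymplectic statistical manifold is a statistical manifold $(M,g,\nabla,\nabla^{*})$ together with an almost cosymplectic structure $(\phi,\xi,\eta,g)$ with the same metric $g$. $R$ and $R^{*}$ are the curvature tensors of $\nabla$ and $\nabla^{*}$, with $R(X,Y)Z=\nabla_{X}\nabla_{Y}Z-\nabla_{Y}\nabla_{X}Z-\nabla_{[X,Y]}Z$ (similarly $R^{*}$), and $S,S^{*}$ are the Ricci tensors $S(Y,Z)=\operatorname{tr}(X\mapsto R(X,Y)Z)$, $S^{*}(Y,Z)=\operatorname{tr}(X\mapsto R^{*}(X,Y)Z)$. *)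

(* Defs.v *)
From HB Require Import structures.
From mathcomp Require Import all_boot all_order all_algebra.
From mathcomp Require Import all_classical all_reals topology normedtype derive.
Set Implicit Arguments.
Unset Strict Implicit.
Unset Printing Implicit Defensive.
Import Order.TTheory GRing.Theory Num.Theory.
Import numFieldNormedType.Exports.
Local Open Scope classical_set_scope.
Local Open Scope ring_scope.

(** * Smooth maps between open subsets of normed spaces *)

(* C^k on U, meant for U open: k times Frechet differentiable, the k-th
   differential being continuous.  "Df is C^k" is expressed as "every
   directional derivative of f is C^k", which is faithful only because the
   source is finite dimensional. *)
Fixpoint Ck_on (R : realType) (m : nat) (W : normedModType R) (k : nat)
    (U : set 'rV[R]_m) (f : 'rV[R]_m -> W) : Prop :=
  match k with
  | 0%N => forall x, U x -> {for x, continuous f}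
  | k'.+1 => (forall x, U x -> differentiable f x) /\
             (forall v : 'rV[R]_m, Ck_on k' U ('D_v f))
  end.

Definition Coo_on (R : realType) (m : nat) (W : normedModType R)
    (U : set 'rV[R]_m) (f : 'rV[R]_m -> W) : Prop :=
  forall k, Ck_on k U f.

(** * Smooth manifolds *)

(* The values of [chart_map] off [chart_dom] and of [chart_inv] off
   [chart_map @` chart_dom] are junk. *)
Record chart (R : realType) (m : nat) (M : topologicalType) := Chart {
  chart_dom : set M;
  chart_map : M -> 'rV[R]_m;
  chart_inv : 'rV[R]_m -> M;
  chart_open_dom : open chart_dom;
  chart_open_img : open (chart_map @` chart_dom);
  chart_mapK : forall p, chart_dom p -> chart_inv (chart_map p) = p;
  chart_map_continuous : forall p, chart_dom p -> {for p, continuous chart_map};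
  chart_inv_continuous :
    forall x, (chart_map @` chart_dom) x -> {for x, continuous chart_inv} }.

Record manifold (R : realType) (m : nat) := Manifold {
  space :> topologicalType;
  space_hausdorff : hausdorff_space space;
  space_second_countable : @second_countable space;
  atlas : set (chart R m space);
  atlas_compatible : forall c d, atlas c -> atlas d ->
    Coo_on (chart_map c @` (chart_dom c `&` chart_dom d))
      (chart_map d \o chart_inv c);
  (* a preferred chart around each point; it carries no extra structure, it
     only fixes coordinates on the tangent space at that point *)
  chart_at : space -> chart R m space;
  chart_at_atlas : forall p, atlas (chart_at p);
  chart_at_dom : forall p, chart_dom (chart_at p) p }.

(* The tangent space T_p M is 'rV[R]_m, a tangent vector at p being given by
   its components in [chart_at p].  Hence a not necessarily smooth section of
   the tangent bundle is a function M -> 'rV[R]_m, and a section of End(TM),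
   T^*M or T^*M (x) T^*M is a matrix-valued function.  Since [chart_at p] may
   jump with p, smoothness of a section never means smoothness of that
   function: it is expressed below by components in a fixed chart. *)

Section Manifold.
Context {R : realType} {m : nat} {M : manifold R m}.
Implicit Types (p q : M) (v w : 'rV[R]_m) (c : chart R m M).
Implicit Types (f : M -> R) (X Y Z xi : M -> 'rV[R]_m).
Implicit Types (phi g : M -> 'M[R]_m) (eta : M -> 'cV[R]_m).
Implicit Types (nabla : (M -> 'rV[R]_m) -> (M -> 'rV[R]_m) -> (M -> 'rV[R]_m)).
Implicit Types (T : (M -> 'rV[R]_m) -> (M -> 'rV[R]_m)).

Definition coords p : M -> 'rV[R]_m := chart_map (chart_at p).
Definition coords_inv p : 'rV[R]_m -> M := chart_inv (chart_at p).

(* The differential at p of a map into a normed space. *)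
Definition dmap (W : normedModType R) (h : M -> W) p v : W :=
  'D_v (h \o coords_inv p) (coords p p).

Definition smooth_in c (W : normedModType R) (h : M -> W) : Prop :=
  Coo_on (chart_map c @` chart_dom c) (h \o chart_inv c).

Definition smooth_fun f : Prop := forall c, atlas c -> smooth_in c (f : M -> R^o).

(* The components in the chart c of the tangent vector v at p. *)
Definition components c p v : 'rV[R]_m := dmap (chart_map c) p v.

(* The coordinate vector d/dx^i of the chart c, as an element of T_p M. *)
Definition coord_vector c (i : 'I_m) p : 'rV[R]_m :=
  'D_(delta_mx 0 i) (coords p \o chart_inv c) (chart_map c p).

Definition smooth_vfield X : Prop :=
  forall c, atlas c -> smooth_in c (fun p => components c p (X p)).

(* A (1,1)-tensor field phi acts on T_p M by v |-> v *m phi p. *)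
Definition smooth_endo phi : Prop := forall c, atlas c -> forall i,
  smooth_in c (fun p => components c p (coord_vector c i p *m phi p)).

Definition form1 eta p v : R := (v *m eta p) 0 0.
Definition form2 g p v w : R := (v *m g p *m w^T) 0 0.

Definition smooth_form1 eta : Prop := forall c, atlas c -> forall i,
  smooth_in c (fun p => form1 eta p (coord_vector c i p) : R^o).

Definition smooth_form2 g : Prop := forall c, atlas c -> forall i j,
  smooth_in c
    (fun p => form2 g p (coord_vector c i p) (coord_vector c j p) : R^o).

Definition endo_app phi X : M -> 'rV[R]_m := fun p => X p *m phi p.
Definition ev1 eta X : M -> R := fun p => form1 eta p (X p).
Definition ev2 g X Y : M -> R := fun p => form2 g p (X p) (Y p).
Definition fmul f X : M -> 'rV[R]_m := fun p => f p *: X p.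

(* The derivative X(f) of a function along a vector field. *)
Definition lie_fun X f : M -> R := fun p => dmap (f : M -> R^o) p (X p).

(* [X, Y]^j = X^i d_i Y^j - Y^i d_i X^j, computed at p in [chart_at p]. *)
Definition bracket X Y : M -> 'rV[R]_m := fun p =>
  dmap (fun q => components (chart_at p) q (Y q)) p (X p)
  - dmap (fun q => components (chart_at p) q (X q)) p (Y p).

(* The trace at p of T, i.e. the trace of the endomorphism of T_p M that T
   induces.  A C^oo(M)-linear T induces exactly one; the default value 0 is for
   maps T that induce none. *)
Definition trace_at p T : R :=
  \tr (xget 0 [set L : 'M[R]_m |
    forall X, smooth_vfield X -> T X p = X p *m L]).

(** * Connections, curvature, statistical structures *)

Record riemannian_metric g : Prop := {
  metric_smooth : smooth_form2 g;
  metric_sym : forall p v w, form2 g p v w = form2 g p w v;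
  metric_pos : forall p v, v != 0 -> 0 < form2 g p v v }.

(* A connection is an operator on smooth vector fields; its values on other
   sections are junk. *)
Record affine_connection nabla : Prop := {
  conn_smooth : forall X Y, smooth_vfield X -> smooth_vfield Y ->
    smooth_vfield (nabla X Y);
  conn_addl : forall X X' Y,
    smooth_vfield X -> smooth_vfield X' -> smooth_vfield Y ->
    nabla (X \+ X') Y = nabla X Y \+ nabla X' Y;
  conn_mull : forall f X Y,
    smooth_fun f -> smooth_vfield X -> smooth_vfield Y ->
    nabla (fmul f X) Y = fmul f (nabla X Y);
  conn_addr : forall X Y Y',
    smooth_vfield X -> smooth_vfield Y -> smooth_vfield Y' ->
    nabla X (Y \+ Y') = nabla X Y \+ nabla X Y';
  conn_leibniz : forall f X Y,
    smooth_fun f -> smooth_vfield X -> smooth_vfield Y ->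
    nabla X (fmul f Y) = fmul (lie_fun X f) Y \+ fmul f (nabla X Y) }.

Definition torsion_free nabla : Prop := forall X Y,
  smooth_vfield X -> smooth_vfield Y ->
  forall p, nabla X Y p - nabla Y X p = bracket X Y p.

Definition dual_connections g nabla nabla' : Prop := forall X Y Z,
  smooth_vfield X -> smooth_vfield Y -> smooth_vfield Z ->
  forall p, lie_fun Z (ev2 g X Y) p
            = ev2 g (nabla Z X) Y p + ev2 g X (nabla' Z Y) p.

Record levi_civita g nabla0 : Prop := {
  lc_connection : affine_connection nabla0;
  lc_torsion_free : torsion_free nabla0;
  lc_metric : dual_connections g nabla0 nabla0 }.

Record statistical_structure g nabla nabla' : Prop := {
  stat_metric : riemannian_metric g;
  stat_connection : affine_connection nabla;
  stat_connection' : affine_connection nabla';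
  stat_torsion_free : torsion_free nabla;
  stat_torsion_free' : torsion_free nabla';
  stat_dual : dual_connections g nabla nabla' }.

Definition difference nabla nabla0 X Y : M -> 'rV[R]_m :=
  fun p => nabla X Y p - nabla0 X Y p.

Definition curvature nabla X Y Z : M -> 'rV[R]_m := fun p =>
  nabla X (nabla Y Z) p - nabla Y (nabla X Z) p - nabla (bracket X Y) Z p.

Definition ricci nabla Y Z : M -> R := fun p =>
  trace_at p (fun X => curvature nabla X Y Z).

(** * Almost cosymplectic structures *)

Definition d1 eta X Y : M -> R := fun p =>
  lie_fun X (ev1 eta Y) p - lie_fun Y (ev1 eta X) p - ev1 eta (bracket X Y) p.

Definition fundamental_form phi g X Y : M -> R := ev2 g (endo_app phi X) Y.

Definition d2 (Phi : (M -> 'rV[R]_m) -> (M -> 'rV[R]_m) -> M -> R) X Y Z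
  : M -> R := fun p =>
  lie_fun X (Phi Y Z) p - lie_fun Y (Phi X Z) p + lie_fun Z (Phi X Y) p
  - Phi (bracket X Y) Z p + Phi (bracket X Z) Y p - Phi (bracket Y Z) X p.

Record almost_contact_metric phi xi eta g : Prop := {
  ac_phi : smooth_endo phi;
  ac_xi : smooth_vfield xi;
  ac_eta : smooth_form1 eta;
  ac_metric : riemannian_metric g;
  ac_phi2 : forall p v, v *m phi p *m phi p = - v + form1 eta p v *: xi p;
  ac_eta_xi : forall p, form1 eta p (xi p) = 1;
  ac_compat : forall p v w, form2 g p (v *m phi p) (w *m phi p)
    = form2 g p v w - form1 eta p v * form1 eta p w }.

Record almost_cosymplectic phi xi eta g : Prop := {
  acs_contact : almost_contact_metric phi xi eta g;
  acs_d_eta : forall X Y, smooth_vfield X -> smooth_vfield Y ->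
    forall p, d1 eta X Y p = 0;
  acs_d_Phi : forall X Y Z,
    smooth_vfield X -> smooth_vfield Y -> smooth_vfield Z ->
    forall p, d2 (fundamental_form phi g) X Y Z p = 0 }.

Definition almost_cosymplectic_statistical phi xi eta g nabla nabla' : Prop :=
  almost_cosymplectic phi xi eta g /\ statistical_structure g nabla nabla'.

Definition shape_op nabla xi X : M -> 'rV[R]_m := fun p => - nabla X xi p.

(* (K_Z phi) X for the endomorphism K_Z of the tangent bundle. *)
Definition difference_act nabla nabla0 Z phi X : M -> 'rV[R]_m := fun p =>
  difference nabla nabla0 Z (endo_app phi X) p
  - endo_app phi (difference nabla nabla0 Z X) p.

End Manifold.

(* Main.v *)
Require Import Defs.
From HB Require Import structures.
From mathcomp Require Import all_boot all_order all_algebra.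
From mathcomp Require Import all_classical all_reals topology normedtype derive.
From mathcomp Require Import landau sequences realfun exp ring lra.
Set Implicit Arguments.
Unset Strict Implicit.
Unset Printing Implicit Defensive.
Import Order.TTheory GRing.Theory Num.Theory.
Import numFieldNormedType.Exports.
Local Open Scope classical_set_scope.
Local Open Scope ring_scope.

(** Write D for the covariant derivative along xi, A0 = - nabla0 xi for the
    shape operator and K for the difference tensor along xi, where nabla0 is the
    Levi-Civita connection.  Since the mean of nabla and nabla' is metric and
    torsion-free, it equals nabla0 ([statistical_mean]); hence nabla_xi = D + K
    and A = A0 - K, while the dual connection has nabla'_xi = D - K and
    A' = A0 + K ([shape_opE], [shape_op'E]).

    From d eta = 0 one gets that A0 is symmetric, that A0 xi = 0 and that
    D xi = 0.  Evaluating d Phi = 0 on xi, Y, Z gives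
    D phi - phi D = phi A0 + A0 phi; together with phi^3 = - phi this forces both
    sides to vanish ([D_phi_A0_phi]).  The hypothesis on K says that phi and K
    commute.

    As nabla_xi xi = 0, the operator X |-> R(X, xi) xi is
      [D, A0] - [D, K] + 2 K A0 - K^2 - A0^2
    and that of the dual connection is obtained by replacing K by - K.  Their sum
    is 2 Q with Q = [D, A0] - A0^2 - K^2, and A^2 + A'^2 = 2 (A0^2 + K^2).
    Conjugation by phi sends [D, A0] to itself and A0^2 + K^2 to its opposite,
    which gives the first identity ([curvature_phi_identity]).  The second one is
    its trace, because tr (phi Q phi) = - tr Q, Q xi being 0 ([ricci_sum]).

    Taking traces at a point requires that each operator be given there by a
    unique matrix.  Uniqueness holds because every tangent vector extends to a
    smooth vector field ([smooth_vfield_through]), which is shown by cutting off a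
    constant field in a chart with a bump function made from exp(-1/t).  Existence
    holds because all the operators involved have an adjoint for the metric
    ([adjoint_op_matrix]), so that no localisation argument is needed. *)

(** * Derivatives and local equality *)

Section NearDifferentiable.
Context {R : realType} {V W : normedModType R}.
Implicit Types (f g : V -> W) (x v : V).

Lemma near_eq_differentiable f g x :
  (\near x, f x = g x) -> differentiable f x -> differentiable g x.
Proof.
move=> fg df.
have h0 : \near x, (g \- f) x = 0.
  by near=> y; rewrite /= (near fg y)// subrr.
suff dh : differentiable (g \- f) x.
  have -> : g = (g \- f) + f by apply/funext => y; rewrite fctE/= subrK.
  exact: differentiableD.
have h1 : \forall y \near 0, (g \- f) (y + x) = 0.
  have := h0; rewrite (near_shift 0 x)/= => h1.
  by apply: filterS h1 => y /=; rewrite subr0.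
have hE : (g \- f) \o shift x = cst ((g \- f) x) + (\0 : V -> W) +o_ 0 id.
  apply/eqaddoP => e e0; near=> y.
  have hy : (g \- f) (y + x) = 0 by near: y; exact: h1.
  have hx : (g \- f) x = 0 by exact: (nbhs_singleton h0).
  rewrite [X in `|X|](_ : _ = 0).
    by rewrite normr0 mulr_ge0 // ltW.
  change ((g \- f) (y + x) - ((g \- f) x + 0) = 0).
  by rewrite hy hx addr0 subr0.
apply/diff_locallyP.
have c0 : continuous (\0 : {linear V -> W}) by exact: cst_continuous.
rewrite (diff_unique c0 hE); split => //.
Unshelve. all: by end_near. Qed.

Lemma derive_comp (U : normedModType R) (h : U -> V) f (y w : U) :
  differentiable h y -> differentiable f (h y) ->
  'D_w (f \o h) y = 'D_('D_w h y) f (h y).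
Proof.
move=> dh df; rewrite !deriveE //; last exact: differentiable_comp.
by rewrite diff_comp.
Qed.

Lemma differentiable_deriveD f x v w : differentiable f x ->
  'D_(v + w) f x = 'D_v f x + 'D_w f x.
Proof. by move=> df; rewrite !deriveE // linearD. Qed.

Lemma differentiable_deriveZ f x (a : R) v : differentiable f x ->
  'D_(a *: v) f x = a *: 'D_v f x.
Proof. by move=> df; rewrite !deriveE // linearZ. Qed.

Lemma differentiable_derive_sum I (r : seq I) (F : I -> V) f x :
  differentiable f x ->
  'D_(\sum_(i <- r) F i) f x = \sum_(i <- r) 'D_(F i) f x.
Proof.
move=> df; rewrite deriveE // linear_sum; apply: eq_bigr => i _.
by rewrite deriveE.
Qed.

Lemma derive_linear (L : {linear V -> W}) x v : continuous L ->
  'D_v L x = L v.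
Proof.
by move=> cL; rewrite deriveE ?diff_lin //; exact: linear_differentiable.
Qed.

End NearDifferentiable.

(** * Calculus of C^k maps *)

Section Ck.
Context {R : realType} {m : nat}.
Implicit Types (U V : set 'rV[R]_m) (W : normedModType R) (k : nat).

Lemma Ck_ext W k U (f g : 'rV[R]_m -> W) : open U ->
  (forall x, U x -> f x = g x) -> Ck_on k U f -> Ck_on k U g.
Proof.
move=> oU; elim: k f g => [|k IH] f g fg.
  move=> cf x Ux; rewrite /prop_for /continuous_at -(fg _ Ux).
  apply: cvg_trans (cf x Ux); apply: (@near_eq_cvg _ _ (nbhs x)).
  exact: filterS fg (open_nbhs_nbhs (conj oU Ux)).
have nfg x : U x -> \near x, f x = g x.
  by move=> Ux; exact: filterS fg (open_nbhs_nbhs (conj oU Ux)).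
move=> [df Df]; split.
  by move=> x Ux; exact: near_eq_differentiable (nfg _ Ux) (df _ Ux).
move=> v; apply: IH (Df v) => x Ux.
exact: near_eq_derive (nfg _ Ux).
Qed.

Lemma CkS W k U (f : 'rV[R]_m -> W) : Ck_on k.+1 U f -> Ck_on k U f.
Proof.
elim: k f => [|k IH] f [df Df].
  by move=> x Ux; exact: differentiable_continuous (df _ Ux).
by split => // v; exact: IH.
Qed.

Lemma Ck_setU W k U V (f : 'rV[R]_m -> W) :
  Ck_on k U f -> Ck_on k V f -> Ck_on k (U `|` V) f.
Proof.
elim: k f => [|k IH] f; first by move=> cU cV x [/cU|/cV].
move=> [dU DU] [dV DV]; split => [x [Ux|Vx]|v].
- exact: dU.
- exact: dV.
- exact: IH (DU v) (DV v).
Qed.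

Lemma Ck_cst W k U (a : W) : open U -> Ck_on k U (cst a : 'rV[R]_m -> W).
Proof.
move=> oU; elim: k a => [|k IH] a /=; first by move=> x _; exact: cst_continuous.
split=> // v; apply: Ck_ext (IH 0) => // x _.
by rewrite derive_cst.
Qed.

Lemma CkD W k U (f g : 'rV[R]_m -> W) : open U ->
  Ck_on k U f -> Ck_on k U g -> Ck_on k U (f \+ g).
Proof.
move=> oU; elim: k f g => [|k IH] f g /=.
  by move=> cf cg x Ux; apply: continuousD; [exact: cf|exact: cg].
move=> [df Df] [dg Dg]; split=> [x Ux|v].
  by apply: differentiableD; [exact: df|exact: dg].
apply: Ck_ext (IH _ _ (Df v) (Dg v)) => // x Ux /=.
rewrite -[in RHS]/(f + g) deriveD //; apply: diff_derivable; [exact: df|exact: dg].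
Qed.

Lemma Ck_sum W k U I (r : seq I) (F : I -> 'rV[R]_m -> W) : open U ->
  (forall i, Ck_on k U (F i)) -> Ck_on k U (fun x => \sum_(i <- r) F i x).
Proof.
move=> oU HF; elim: r => [|i r IH].
  by apply: Ck_ext (Ck_cst k 0 oU) => // x _; rewrite big_nil.
by apply: Ck_ext (CkD oU (HF i) IH) => // x _; rewrite big_cons.
Qed.

Lemma Ck_linear W W' k U (L : {linear W -> W'}) (f : 'rV[R]_m -> W) : open U ->
  continuous L -> Ck_on k U f -> Ck_on k U (L \o f).
Proof.
move=> oU cL; elim: k f => [|k IH] f /=.
  by move=> cf x Ux; apply: continuous_comp; [exact: cf|exact: cL].
move=> [df Df]; split=> [x Ux|v].
  by apply: differentiable_comp; [exact: df|exact: linear_differentiable].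
apply: Ck_ext (IH _ (Df v)) => // x Ux /=.
have dL y : differentiable L y by exact: linear_differentiable.
by rewrite (derive_comp v (df _ Ux) (dL _)) derive_linear.
Qed.

Lemma CkM k U (f g : 'rV[R]_m -> R^o) : open U ->
  Ck_on k U f -> Ck_on k U g -> Ck_on k U (fun x => f x * g x : R^o).
Proof.
move=> oU; elim: k f g => [|k IH] f g.
  by move=> cf cg x Ux; apply: continuousM; [exact: cf|exact: cg].
move=> Cf Cg; have [df Df] := Cf; have [dg Dg] := Cg; split=> [x Ux|v].
  by apply: (@differentiableM R _ f g); [exact: df|exact: dg].
apply: Ck_ext (CkD oU (IH _ _ (CkS Cf) (Dg v)) (IH _ _ (CkS Cg) (Df v))) => //.
move=> x Ux /=.
rewrite (@deriveM _ _ f g) //; apply: diff_derivable; [exact: df|exact: dg].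
Qed.

Lemma Ck_scalel W k U (f : 'rV[R]_m -> R^o) (w : W) : open U ->
  Ck_on k U f -> Ck_on k U (fun x => f x *: w).
Proof.
move=> oU.
pose L : R^o -> W := fun a => a *: w.
have lL : linear L.
  by move=> a u v; rewrite /L scalerDl /= scalerA.
pose L' : {linear R^o -> W} := HB.pack L (GRing.isLinear.Build _ _ _ _ L lL).
by move=> Cf; apply: (@Ck_linear _ _ _ _ L') => //; exact: scalel_continuous.
Qed.

Lemma Ck_coord n k U (f : 'rV[R]_m -> 'rV[R]_n) j : open U ->
  Ck_on k U f -> Ck_on k U (fun x => f x 0 j : R^o).
Proof.
move=> oU.
pose L : 'rV[R]_n -> R^o := fun a => a 0 j.
have lL : linear L by move=> a u v; rewrite /L !mxE.
pose L' : {linear 'rV[R]_n -> R^o} := HB.pack L (GRing.isLinear.Build _ _ _ _ L lL).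
by move=> Cf; apply: (@Ck_linear _ _ _ _ L') => //; exact: coord_continuous.
Qed.

Lemma Ck_coords n k U (f : 'rV[R]_m -> 'rV[R]_n) : open U ->
  (forall j, Ck_on k U (fun x => f x 0 j : R^o)) -> Ck_on k U f.
Proof.
move=> oU Hf.
pose F (j : 'I_n) := fun x => f x 0 j *: (delta_mx 0 j : 'rV[R]_n).
apply: (@Ck_ext _ _ _ (fun x => \sum_j F j x)) => //.
  by move=> x _; rewrite /F -row_sum_delta.
by apply: Ck_sum => // j; apply: Ck_scalel.
Qed.

Lemma CkZ n k U (a : 'rV[R]_m -> R^o) (f : 'rV[R]_m -> 'rV[R]_n) : open U ->
  Ck_on k U a -> Ck_on k U f -> Ck_on k U (fun x => a x *: f x).
Proof.
move=> oU Ca Cf; apply: Ck_coords => // j.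
apply: (@Ck_ext _ _ _ (fun x => a x * f x 0 j : R^o)) => //.
  by move=> x _; rewrite mxE.
by apply: CkM => //; exact: Ck_coord.
Qed.

Lemma Ck_id k U : open U -> Ck_on k U (@id 'rV[R]_m).
Proof.
move=> oU; case: k => [|k]; first by move=> x _; exact: cvg_id.
split => [x _|v]; first by [].
apply: Ck_ext (Ck_cst _ v oU) => // x _; by rewrite derive_id.
Qed.

(** Chain rule: each directional derivative of [f \o h] is a combination of the
    partial derivatives of [f], composed with [h], whose coefficients are the
    components of the corresponding derivative of [h]. *)
Lemma Ck_comp k U V (h : 'rV[R]_m -> 'rV[R]_m) (f : 'rV[R]_m -> R^o) :
  open U -> open V -> (forall x, U x -> V (h x)) ->
  Ck_on k U h -> Ck_on k V f -> Ck_on k U (f \o h).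
Proof.
move=> oU oV hUV; elim: k f => [|k IH] f.
  by move=> ch cf x Ux; apply: continuous_comp; [exact: ch|exact: cf (hUV _ Ux)].
move=> Ch [df Df]; have [dh Dh] := Ch; split => [x Ux|v].
  by apply: differentiable_comp; [exact: dh|exact: df (hUV _ Ux)].
pose F (j : 'I_m) x := ('D_v h x) 0 j * ('D_(delta_mx 0 j) f \o h) x : R^o.
apply: (@Ck_ext _ _ _ (fun x => \sum_j F j x)) => //.
  move=> x Ux; have dfx := df _ (hUV _ Ux); rewrite (derive_comp v (dh _ Ux) dfx).
  rewrite [in RHS](row_sum_delta ('D_v h x)) differentiable_derive_sum //.
  by apply: eq_bigr => j _; rewrite differentiable_deriveZ.
apply: Ck_sum => // j; apply: CkM => //; first exact: Ck_coord (Dh v).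
exact: IH (CkS Ch) (Df _).
Qed.

End Ck.

(** * A smooth bump function *)

Section FlatFunction.
Context {R : realType}.
Implicit Types (t : R) (n : nat).

(** The functions [t^-n * exp(-1/t)], extended by 0 to [t <= 0].  They are
    smooth on the whole line because the derivative of each is a combination of
    two others. *)
Definition flat n t : R := if 0 < t then t^-1 ^+ n * expR (- t^-1) else 0.

Lemma flat_le0 n t : t <= 0 -> flat n t = 0.
Proof. by rewrite /flat leNgt => /negbTE ->. Qed.

Lemma flat0_gt0 t : 0 < t -> 0 < flat 0 t.
Proof. by move=> t0; rewrite /flat t0 expr0 mul1r expR_gt0. Qed.

(** A quadratic bound, so that [flat n] has derivative 0 at 0. *)
Lemma flat_bound n t : `|flat n t| <= n.+2`!%:R * t ^+ 2.
Proof.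
rewrite /flat; case: ifPn => [t0|_]; last first.
  by rewrite normr0 mulr_ge0 ?sqr_ge0.
have s0 : 0 < t^-1 by rewrite invr_gt0.
rewrite ger0_norm; last by rewrite mulr_ge0 ?expR_ge0 // exprn_ge0 // ltW.
have f0 : (0 : R) < n.+2`!%:R by rewrite ltr0n fact_gt0.
have H : t^-1 ^+ n.+2 / n.+2`!%:R <= expR t^-1.
  apply: le_trans (expR_ge1Dxn n.+1 (ltW s0)); rewrite ler_wpDl //.
rewrite expRN -(ler_pM2r (expR_gt0 t^-1)) -mulrA mulVf ?expR_eq0 // mulr1.
apply: le_trans (ler_wpM2l _ H); last by rewrite mulr_ge0 ?sqr_ge0.
rewrite le_eqVlt; apply/orP; left; apply/eqP.
rewrite -addn2 exprD; field.
by rewrite addn2 (gt_eqF f0) (gt_eqF t0).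
Qed.

Lemma is_derive_flat n t :
  is_derive t 1 (flat n) (- n%:R * flat n.+1 t + flat n.+2 t).
Proof.
have [t0|t0|->] := ltgtP t 0.
- rewrite !flat_le0 ?ltW // mulr0 addr0.
  apply: (@near_eq_is_derive _ _ _ (cst 0)).
  near=> s; rewrite flat_le0 //; near: s; apply: filterS (lt_nbhsl t0).
  by move=> s /ltW.
- have tn0 : t != 0 by rewrite gt_eqF.
  have nE : \near t, t^-1 ^+ n * expR (- t^-1) = flat n t.
    near=> s; have s0 : 0 < s by near: s; exact: lt_nbhsr t0.
    by rewrite /flat s0.
  pose v : R -> R := fun s => s^-1.
  have dv : is_derive t 1 v (- t^-1 ^+ 2).
    apply: DeriveDef; first exact: (@derivableV _ _ id).
    by rewrite (@deriveV _ _ id) // derive_id exprVn [LHS]mulr1.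
  have dN : is_derive t 1 (- v) (t^-1 ^+ 2).
    by apply: is_derive_eq; rewrite opprK.
  have dE : is_derive t 1 (expR \o (- v)) (expR (- t^-1) * t^-1 ^+ 2).
    exact: is_derive1_comp.
  have dX : is_derive t 1 (v ^+ n) (n%:R * t^-1 ^+ n.-1 * - t^-1 ^+ 2).
    exact: is_deriveX.
  apply: (near_eq_is_derive nE).
  have -> : (fun s : R => s^-1 ^+ n * expR (- s^-1)) = v ^+ n * (expR \o (- v)).
    by apply/funext => s; rewrite !fctE.
  apply: (is_derive_eq (is_deriveM dX dE)).
  rewrite /flat t0 !fctE /v /GRing.scale /=.
  case: (n) => [|k]; first by rewrite !expr0 /=; ring.
  by rewrite /= !exprS; ring.
- rewrite !flat_le0 // mulr0 addr0.
  have H : (fun h : R => h^-1 *: (flat n (h *: 1 + 0) - flat n 0)) h @[h --> 0^'] --> 0.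
    have f0 : (0 : R) < n.+2`!%:R by rewrite ltr0n fact_gt0.
    apply/cvgrPdist_le => e e0; near=> h.
    rewrite addr0 (flat_le0 n (lexx 0)) subr0 sub0r normrN normrZ normfV.
    have h0 : 0 < `|h| by rewrite normr_gt0; near: h; exact: nbhs_dnbhs_neq.
    rewrite ler_pdivrMl //; apply: le_trans (flat_bound _ _) _.
    rewrite [h%:A]mulr1 -real_normK ?num_real // expr2 mulrCA ler_wpM2l //.
    rewrite -ler_pdivlMl //; near: h; apply: dnbhs0_le.
    by rewrite mulr_gt0 ?invr_gt0.
  apply: DeriveDef; first by apply/cvg_ex; exists 0.
  exact: cvg_lim H.
Unshelve. all: by end_near. Qed.

Lemma Ck_flat m (U : set 'rV[R]_m) k n (u : 'rV[R]_m -> R^o) : open U ->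
  Ck_on k U u -> Ck_on k U (fun x => flat n (u x) : R^o).
Proof.
have dflat j t : differentiable (flat j : R^o -> R^o) t.
  by apply/derivable1_diffP; case: (is_derive_flat j t).
move=> oU; elim: k n => [|k IH] n Cu.
  move=> x Ux; apply: (@continuous_comp _ _ _ u (flat n)); first exact: Cu.
  exact: differentiable_continuous.
have [du Du] := Cu; split => [x Ux|w].
  by apply: (@differentiable_comp _ _ _ _ u (flat n)); first exact: du.
pose F x : R^o := 'D_w u x * (- n%:R * flat n.+1 (u x) + flat n.+2 (u x)).
apply: (@Ck_ext _ _ _ _ _ F) => //.
  move=> x Ux; rewrite /F (derive_comp w (du _ Ux) (dflat n _)).
  have := differentiable_deriveZ ('D_w u x) (1 : R^o) (dflat n (u x)).
  have [_ ->] := is_derive_flat n (u x).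
  by rewrite [_ *: (1 : R^o)]mulr1.
have Cu' := CkS Cu.
apply: CkM => //; first exact: Du.
have C1 : Ck_on k U (fun x => - n%:R * flat n.+1 (u x) : R^o).
  by apply: CkM; [|exact: (@Ck_cst _ _ R^o)|exact: IH].
exact: CkD oU C1 (IH n.+2 Cu').
Qed.

(** [flat 0], normalised at [x0] and composed with the difference of [r^2] and
    the square of the Euclidean distance to [x0].  The norm in the statement is
    the supremum norm, which is at most the Euclidean one. *)
Lemma smooth_bump m (x0 : 'rV[R]_m) (r : R) : 0 < r ->
  exists b : 'rV[R]_m -> R^o, [/\ Coo_on setT b, b x0 = 1 &
    forall x, b x != 0 -> `|x - x0| <= r].
Proof.
move=> r0.
pose u (x : 'rV[R]_m) : R^o := r ^+ 2 - \sum_j (x 0 j - x0 0 j) * (x 0 j - x0 0 j).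
have Cu : Coo_on setT u.
  move=> k; have oT := @openT 'rV[R]_m.
  have Cx j : Ck_on k setT (fun x : 'rV[R]_m => x 0 j - x0 0 j : R^o).
    apply: (@CkD _ _ R^o _ _ (fun x : 'rV[R]_m => x 0 j : R^o) (cst (- x0 0 j))) => //.
      by apply: Ck_coord => //; exact: Ck_id.
    exact: Ck_cst.
  apply: (@Ck_ext _ _ _ _ _ (fun x => r ^+ 2 +
    \sum_j (- 1) * ((x 0 j - x0 0 j) * (x 0 j - x0 0 j)))) => //.
    by move=> x _; rewrite -mulr_sumr mulN1r.
  apply: (@CkD _ _ R^o _ _ (cst (r ^+ 2))) => //; first exact: Ck_cst.
  apply: (@Ck_sum _ _ R^o) => // j; apply: CkM => //; first exact: Ck_cst.
  by apply: CkM.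
have ux0 : u x0 = r ^+ 2.
  by rewrite /u big1 ?subr0 // => j _; rewrite subrr mul0r.
pose c := flat 0 (u x0).
have c0 : c != 0 by rewrite gt_eqF // flat0_gt0 // ux0 exprn_gt0.
exists (fun x => c^-1 * flat 0 (u x)); split.
- move=> k; apply: CkM; [exact: openT|exact/Ck_cst/openT|].
  by apply: Ck_flat; [exact: openT|exact: Cu].
- exact: mulVf.
- move=> x; rewrite mulf_eq0 invr_eq0 (negbTE c0) /=.
  have [/(flat_le0 0)->|ux _] := leP (u x) 0; first by rewrite eqxx.
  rewrite [leLHS]/Num.Def.normr/= mx_normrE (bigmax_le _ (ltW r0))// => -[i j] _.
  rewrite !mxE (ord1 i) /= -ler_sqr ?nnegrE ?(ltW r0) //.
  rewrite real_normK ?num_real //; apply: le_trans (ltW (_ : _ < r ^+ 2)) => //.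
  move: ux; rewrite /u subr_gt0; apply: le_lt_trans.
  rewrite (bigD1 j) //= -expr2 lerDl sumr_ge0 // => l _.
  by rewrite -expr2 sqr_ge0.
Qed.

End FlatFunction.

(** * Changes of charts and smooth vector fields *)

Section Charts.
Context {R : realType} {m : nat} {M : manifold R m}.
Implicit Types (a b c d : chart R m M) (p q : M) (v w : 'rV[R]_m).
Implicit Types (X Y : M -> 'rV[R]_m).

Lemma chart_image_open a (O : set M) : open O ->
  open (chart_map a @` (chart_dom a `&` O)).
Proof.
move=> oO; rewrite openE => x [p [ap Op] <-].
have xa : (chart_map a @` chart_dom a) (chart_map a p) by exists p.
have := @chart_inv_continuous _ _ _ a _ xa.
rewrite /prop_for /continuous_at chart_mapK // => ca.
have nO : nbhs p O by exact: open_nbhs_nbhs.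
have n1 := ca _ nO.
have n2 := open_nbhs_nbhs (conj (@chart_open_img _ _ _ a) xa).
have n1' : nbhs (chart_map a p) (chart_inv a @^-1` O) by exact: n1.
suff S : chart_inv a @^-1` O `&` chart_map a @` chart_dom a
    `<=` chart_map a @` (chart_dom a `&` O).
  exact: (@filterS _ (nbhs (chart_map a p)) _ _ _ S (filterI n1' n2)).
move=> y [/= Oy [q aq qy]].
by exists q => //; split => //; move: Oy; rewrite -qy chart_mapK.
Qed.

(** The change of coordinates from the chart [a] to the chart [b]; its values are
    meaningful only on [overlap a b]. *)
Definition transition b a : 'rV[R]_m -> 'rV[R]_m := chart_map b \o chart_inv a.

(** The common domain of two charts, read in the chart [a]. *)
Definition overlap a b : set 'rV[R]_m :=
  chart_map a @` (chart_dom a `&` chart_dom b).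

Lemma overlap_open a b : open (overlap a b).
Proof. exact/chart_image_open/chart_open_dom. Qed.

Lemma overlapP a b p : chart_dom a p -> chart_dom b p ->
  overlap a b (chart_map a p).
Proof. by move=> ap bp; exists p. Qed.

Lemma transition_smooth a b : atlas a -> atlas b ->
  Coo_on (overlap a b) (transition b a).
Proof. exact: atlas_compatible. Qed.

Lemma transition_differentiable a b p : atlas a -> atlas b ->
  chart_dom a p -> chart_dom b p ->
  differentiable (transition b a) (chart_map a p).
Proof.
move=> Aa Ab ap bp; have [dt _] := transition_smooth Aa Ab 1%N.
by apply: dt; exact: overlapP.
Qed.

(** The components in the chart [b] of the tangent vector at [p] whose components
    in the chart [a] are [v].  Both [components] and [coord_vector] are instances,
    with the preferred chart at [p] as source and as target respectively. *)
Definition change b a p v : 'rV[R]_m := 'D_v (transition b a) (chart_map a p).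

Lemma componentsE c p v : components c p v = change c (chart_at p) p v.
Proof. by []. Qed.

Section Change.
Variables (a b c : chart R m M) (p : M).
Hypotheses (Aa : atlas a) (Ab : atlas b) (Ac : atlas c).
Hypotheses (ap : chart_dom a p) (bp : chart_dom b p) (cp : chart_dom c p).

Lemma changeD v w : change b a p (v + w) = change b a p v + change b a p w.
Proof. exact/differentiable_deriveD/transition_differentiable. Qed.

Lemma changeZ (k : R) v : change b a p (k *: v) = k *: change b a p v.
Proof. exact/differentiable_deriveZ/transition_differentiable. Qed.

Lemma change_sum I (r : seq I) (F : I -> 'rV[R]_m) :
  change b a p (\sum_(i <- r) F i) = \sum_(i <- r) change b a p (F i).
Proof. exact/differentiable_derive_sum/transition_differentiable. Qed.

Lemma change_refl v : change a a p v = v.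
Proof.
rewrite /change -[RHS](derive_id (chart_map a p) v); apply: near_eq_derive.
have /open_nbhs_nbhs := conj (@chart_open_img _ _ _ a) (imageP (chart_map a) ap).
by apply: filterS => x [q aq <-]; rewrite /transition /= chart_mapK.
Qed.

Lemma change_comp v : change c b p (change b a p v) = change c a p v.
Proof.
have tp : transition b a (chart_map a p) = chart_map b p.
  by rewrite /transition /= chart_mapK.
rewrite /change -tp -derive_comp; [|exact: transition_differentiable|].
  2: by rewrite tp; exact: transition_differentiable.
apply: near_eq_derive.
have /open_nbhs_nbhs := conj (@overlap_open a b) (overlapP ap bp).
apply: filterS => x [q [aq bq] <-].
by rewrite /transition /= !chart_mapK.
Qed.

End Change.

Section Components.
Variables (c : chart R m M) (p : M).
Hypotheses (Ac : atlas c) (cp : chart_dom c p).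

Lemma componentsD v w : components c p (v + w) = components c p v + components c p w.
Proof. exact: changeD (chart_at_atlas p) Ac (chart_at_dom p) cp _ _. Qed.

Lemma componentsZ (k : R) v : components c p (k *: v) = k *: components c p v.
Proof. exact: changeZ (chart_at_atlas p) Ac (chart_at_dom p) cp _ _. Qed.

Lemma components_sum I (r : seq I) (F : I -> 'rV[R]_m) :
  components c p (\sum_(i <- r) F i) = \sum_(i <- r) components c p (F i).
Proof. exact: change_sum (chart_at_atlas p) Ac (chart_at_dom p) cp _ _ _. Qed.

Lemma components_sum_coord_vector v :
  v = \sum_i components c p v 0 i *: coord_vector c i p.
Proof.
have Aat := chart_at_atlas p; have atp := chart_at_dom p.
transitivity (change (chart_at p) c p (components c p v)).
  by rewrite componentsE change_comp // change_refl.
rewrite {1}(row_sum_delta (components c p v)) change_sum //.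
by apply: eq_bigr => i _; rewrite changeZ.
Qed.

End Components.

Lemma smooth_in_ext (W : normedModType R) c (h k : M -> W) :
  (forall p, chart_dom c p -> h p = k p) -> smooth_in c h -> smooth_in c k.
Proof.
move=> hk H j; apply: Ck_ext (H j); first exact: chart_open_img.
by move=> x [p cp <-] /=; rewrite chart_mapK // hk.
Qed.

Lemma smooth_in_sum (W : normedModType R) c I (r : seq I) (h : I -> M -> W) :
  (forall i, smooth_in c (h i)) -> smooth_in c (fun p => \sum_(i <- r) h i p).
Proof.
move=> H k; apply: (@Ck_sum _ _ _ _ _ _ r (fun i => h i \o chart_inv c)).
  exact: chart_open_img.
by move=> i; exact: H.
Qed.

Lemma smooth_vfieldD X Y : smooth_vfield X -> smooth_vfield Y ->
  smooth_vfield (X \+ Y).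
Proof.
move=> sX sY c Ac; apply: smooth_in_ext (_ : smooth_in c
  (fun p => components c p (X p) + components c p (Y p))).
  by move=> p cp; rewrite componentsD.
move=> k; have := CkD (@chart_open_img _ _ _ c) (sX c Ac k) (sY c Ac k).
exact.
Qed.

Lemma smooth_fun_cst (k : R) : smooth_fun (fun _ : M => k).
Proof. by move=> c _ j; apply: (@Ck_cst _ _ R^o) => //; exact: chart_open_img. Qed.

Lemma smooth_vfieldZ (k : R) X : smooth_vfield X ->
  smooth_vfield (fun p => k *: X p).
Proof.
move=> sX c Ac; apply: smooth_in_ext (_ : smooth_in c
  (fun p => k *: components c p (X p))).
  by move=> p cp; rewrite componentsZ.
move=> j; have oc := @chart_open_img _ _ _ c.
by have := CkZ oc (Ck_cst j (k : R^o) oc) (sX c Ac j).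
Qed.

Lemma smooth_vfield0 : smooth_vfield (fun _ : M => 0 : 'rV[R]_m).
Proof.
move=> c Ac; apply: smooth_in_ext (_ : smooth_in c (fun _ => 0)).
  move=> p cp; have := componentsZ Ac cp 0 0; by rewrite !scale0r => ->.
by move=> k; apply: Ck_cst; exact: chart_open_img.
Qed.

(** In a chart, [phi X] is the combination of the smooth fields
    [phi (d/dx^i)] with the components of [X] as coefficients. *)
Lemma smooth_endo_app (phi : M -> 'M[R]_m) X : smooth_endo phi ->
  smooth_vfield X -> smooth_vfield (endo_app phi X).
Proof.
move=> sphi sX c Ac; apply: smooth_in_ext (_ : smooth_in c (fun p => \sum_i
    components c p (X p) 0 i *: components c p (coord_vector c i p *m phi p))).
  move=> p cp; rewrite /endo_app {2}(components_sum_coord_vector Ac cp (X p)).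
  rewrite mulmx_suml components_sum //; apply: eq_bigr => i _.
  by rewrite -scalemxAl componentsZ.
apply: smooth_in_sum => i k; have oc := @chart_open_img _ _ _ c.
by have := CkZ oc (Ck_coord i oc (sX c Ac k)) (sphi c Ac i k).
Qed.

End Charts.

(** * Extension of tangent vectors to smooth vector fields *)

Section Extension.
Context {R : realType} {m : nat} {M : manifold R m}.

(** Multiplying the constant field [v] of the preferred chart at [p] by a bump
    function and extending it by 0 gives a globally smooth field: its support
    lies in the image of a closed ball, which is compact, hence closed. *)
Lemma smooth_vfield_through (p : M) (v : 'rV[R]_m) :
  exists2 X : M -> 'rV[R]_m, smooth_vfield X & X p = v.
Proof.
pose c := chart_at p; pose x0 := chart_map c p.
have Ac : atlas c := chart_at_atlas p; have cp : chart_dom c p := chart_at_dom p.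
have [e /= e0 He] : nbhs_ball x0 (chart_map c @` chart_dom c).
  apply/nbhs_ballP/open_nbhs_nbhs; split; first exact: chart_open_img.
  by exists p.
(* half the radius, to leave a closed ball inside the open image *)
pose r := e / 2; have r0 : 0 < r by rewrite divr_gt0.
have [b [Cb bx0 bsupp]] := smooth_bump x0 r0.
pose B : set 'rV[R]_m := closed_ball_ Num.norm x0 r.
have Bimg : B `<=` chart_map c @` chart_dom c.
  move=> x /= xr; apply: He; rewrite -ball_normE /=.
  by apply: le_lt_trans xr _; rewrite ltr_pdivrMr // ltr_pMr // ltr1n.
have cB : compact B.
  apply: bounded_closed_compact; last exact: closed_closed_ball_.
  exists (`|x0| + r); split => [|s xs y yr]; first exact: num_real.
  apply: le_trans (ltW xs); rewrite -[y](subrK x0) addrC.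
  by apply: le_trans (ler_normD _ _) _; rewrite lerD2l distrC.
pose K := chart_inv c @` B.
have cK : closed K.
  apply: compact_closed; first exact: space_hausdorff.
  apply: continuous_compact cB; apply: continuous_in_subspaceT => x.
  by rewrite inE => /Bimg; exact: chart_inv_continuous.
pose X (q : M) : 'rV[R]_m :=
  if `[< chart_dom c q >] then b (chart_map c q) *: change (chart_at q) c q v else 0.
have Xin q : chart_dom c q -> X q = b (chart_map c q) *: change (chart_at q) c q v.
  by move=> cq; rewrite /X asboolT.
have Xout q : ~ K q -> X q = 0.
  rewrite /X; case: asboolP => // cq nK.
  have [->|bq] := eqVneq (b (chart_map c q)) 0; first by rewrite scale0r.
  case: nK; exists (chart_map c q); first by rewrite /B /closed_ball_ /= distrC bsupp.
  by rewrite chart_mapK.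
exists X; last by rewrite Xin // bx0 scale1r change_refl.
move=> d Ad k.
have oO : open (~` K) by rewrite openC.
(* X is a smooth multiple of [v] on the domain of [c] and 0 off [K]; these two
   open sets cover the domain of any other chart. *)
have -> : chart_map d @` chart_dom d
    = overlap d c `|` chart_map d @` (chart_dom d `&` ~` K).
  apply/seteqP; split => [x [q dq <-]|x [[q [dq _] <-]|[q [dq _] <-]]];
    try by exists q.
  have [cq|ncq] := pselect (chart_dom c q); [left|right]; exists q => //.
  split => // -[y By qy]; apply: ncq.
  by have [q' cq' qy'] := Bimg y By; rewrite -qy -qy' chart_mapK.
apply: Ck_setU; last first.
  apply: Ck_ext (Ck_cst k 0 _); try exact: chart_image_open.
  move=> x [q [dq nK] <-]; rewrite /= chart_mapK // Xout //.
  by have := componentsZ Ad dq 0 0; rewrite !scale0r => ->.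
have oU := @overlap_open _ _ _ d c; have oV := @overlap_open _ _ _ c d.
have maps x : overlap d c x -> overlap c d (transition c d x).
  by move=> [q [dq cq] <-]; exists q => //; rewrite /transition /= chart_mapK.
have Ct : Ck_on k (overlap d c) (transition c d) by exact: transition_smooth.
apply: (@Ck_ext _ _ _ _ _ (fun x => (b \o transition c d) x *:
    ('D_v (transition d c) \o transition c d) x)) => //.
  move=> x [q [dq cq] <-].
  have E : components d q (X q) = b (chart_map c q) *: change d c q v.
    rewrite (Xin q cq) (componentsZ Ad dq); congr (_ *: _).
    have [Aq qq] := (chart_at_atlas q, chart_at_dom q).
    exact: (change_comp Ac Aq Ad cq qq dq).
  by rewrite /transition /= chart_mapK // E.
have [_ Dt] := transition_smooth Ac Ad k.+1.
apply: CkZ => //.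
  exact: (@Ck_comp _ _ k _ setT _ b oU (@openT _) (fun _ _ => I) Ct (Cb k)).
apply: Ck_coords => // j.
exact: Ck_comp oU oV maps Ct (Ck_coord j oV (Dt v)).
Qed.

End Extension.

(** * Metrics and connections *)

Section Bilinear.
Context {R : realType} {m : nat} {M : manifold R m}.
Variables (g : M -> 'M[R]_m) (p : M).
Implicit Types u v w : 'rV[R]_m.

Lemma form2Dl u v w : form2 g p (u + v) w = form2 g p u w + form2 g p v w.
Proof. by rewrite /form2 !mulmxDl mxE. Qed.
Lemma form2Dr u v w : form2 g p u (v + w) = form2 g p u v + form2 g p u w.
Proof. by rewrite /form2 linearD mulmxDr mxE. Qed.
Lemma form2Nl u w : form2 g p (- u) w = - form2 g p u w.
Proof. by rewrite /form2 !mulNmx mxE. Qed.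
Lemma form2Nr u w : form2 g p u (- w) = - form2 g p u w.
Proof. by rewrite /form2 linearN mulmxN mxE. Qed.
Lemma form2Zl a u w : form2 g p (a *: u) w = a * form2 g p u w.
Proof. by rewrite /form2 -!scalemxAl mxE. Qed.
Lemma form2Zr a u w : form2 g p u (a *: w) = a * form2 g p u w.
Proof. by rewrite /form2 linearZ -scalemxAr mxE. Qed.
Lemma form20l w : form2 g p 0 w = 0.
Proof. by rewrite /form2 !mul0mx mxE. Qed.
Lemma form20r w : form2 g p w 0 = 0.
Proof. by rewrite /form2 linear0 mulmx0 mxE. Qed.

Definition form2E := (form2Dl, form2Dr, form2Nl, form2Nr, form2Zl, form2Zr,
  form20l, form20r).

Hypothesis hg : riemannian_metric g.

Lemma metric_nondeg v : form2 g p v v = 0 -> v = 0.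
Proof.
have [//|v0] := eqVneq v 0.
by move=> gv; have := metric_pos hg p v0; rewrite gv ltxx.
Qed.

End Bilinear.

Section Connections.
Context {R : realType} {m : nat} {M : manifold R m}.
Implicit Types (X Y Z : M -> 'rV[R]_m).
Variables (g : M -> 'M[R]_m).
Variables nabla nabla' : (M -> 'rV[R]_m) -> (M -> 'rV[R]_m) -> (M -> 'rV[R]_m).

Lemma smooth_vfieldN X : smooth_vfield X -> smooth_vfield (fun p => - X p).
Proof.
move=> /(smooth_vfieldZ (-1)); congr smooth_vfield.
by apply/funext => p; rewrite scaleN1r.
Qed.

Lemma smooth_vfieldB X Y : smooth_vfield X -> smooth_vfield Y ->
  smooth_vfield (fun p => X p - Y p).
Proof. by move=> sX /smooth_vfieldN; exact: smooth_vfieldD. Qed.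

Section OneConnection.
Hypothesis cn : affine_connection nabla.

Lemma conn0r X : smooth_vfield X -> nabla X (fun=> 0) = (fun=> 0).
Proof.
move=> sX; have s0 := @smooth_vfield0 R m M.
have := conn_addr cn sX s0 s0.
have -> : (fun=> 0) \+ (fun=> 0) = (fun=> 0) :> (M -> 'rV[R]_m).
  by apply/funext => p /=; rewrite addr0.
move=> E; apply/funext => p.
by apply: (addrI (nabla X (fun=> 0) p)); rewrite -[in LHS]/((_ \+ _) p) -E addr0.
Qed.

Lemma connNr X Y p : smooth_vfield X -> smooth_vfield Y ->
  nabla X (fun q => - Y q) p = - nabla X Y p.
Proof.
move=> sX sY; apply/eqP; rewrite -subr_eq0 opprK addrC.
have := congr1 (fun f => f p) (conn_addr cn sX sY (smooth_vfieldN sY)) => /= <-.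
have -> : Y \+ (fun q => - Y q) = (fun=> 0).
  by apply/funext => q /=; rewrite subrr.
by rewrite conn0r.
Qed.

Lemma connDr X Y Z p : smooth_vfield X -> smooth_vfield Y -> smooth_vfield Z ->
  nabla X (fun q => Y q + Z q) p = nabla X Y p + nabla X Z p.
Proof.
by move=> sX sY sZ; have := congr1 (fun f => f p) (conn_addr cn sX sY sZ).
Qed.

Lemma connBr X Y Z p : smooth_vfield X -> smooth_vfield Y -> smooth_vfield Z ->
  nabla X (fun q => Y q - Z q) p = nabla X Y p - nabla X Z p.
Proof.
move=> sX sY sZ; rewrite (connDr _ sX sY (smooth_vfieldN sZ)).
by rewrite connNr.
Qed.

Lemma connDl X Y Z p : smooth_vfield X -> smooth_vfield Y -> smooth_vfield Z ->
  nabla (fun q => X q + Y q) Z p = nabla X Z p + nabla Y Z p.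
Proof.
by move=> sX sY sZ; have := congr1 (fun f => f p) (conn_addl cn sX sY sZ).
Qed.

Lemma connNl X Y p : smooth_vfield X -> smooth_vfield Y ->
  nabla (fun q => - X q) Y p = - nabla X Y p.
Proof.
move=> sX sY.
have := congr1 (fun f => f p) (conn_mull cn (smooth_fun_cst (-1)) sX sY).
rewrite /fmul scaleN1r => <-; congr (nabla _ Y p).
by apply/funext => q; rewrite scaleN1r.
Qed.

Lemma connBl X Y Z p : smooth_vfield X -> smooth_vfield Y -> smooth_vfield Z ->
  nabla (fun q => X q - Y q) Z p = nabla X Z p - nabla Y Z p.
Proof.
move=> sX sY sZ; rewrite (connDl _ sX (smooth_vfieldN sY) sZ).
by rewrite connNl.
Qed.

Lemma torsion_free_bracket X Y : torsion_free nabla ->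
  smooth_vfield X -> smooth_vfield Y ->
  bracket X Y = (fun p => nabla X Y p - nabla Y X p).
Proof. by move=> tf sX sY; apply/funext => p; rewrite tf. Qed.

End OneConnection.

Lemma ev2C X Y : riemannian_metric g -> ev2 g X Y = ev2 g Y X.
Proof. by move=> hg; apply/funext => p; rewrite /ev2 (Defs.metric_sym hg). Qed.

(** The mean of the two connections of a statistical structure is metric and
    torsion-free, hence is the Levi-Civita connection: the difference [E] is
    symmetric in its two arguments and skew for the metric, hence 0. *)
Lemma statistical_mean nabla0 X Y p : statistical_structure g nabla nabla' ->
  levi_civita g nabla0 -> smooth_vfield X -> smooth_vfield Y ->
  nabla X Y p + nabla' X Y p = nabla0 X Y p + nabla0 X Y p.
Proof.
case=> hg cn cn' tf tf' du [cn0 tf0 du0] sX sY.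
pose E X Y q := nabla X Y q + nabla' X Y q - (nabla0 X Y q + nabla0 X Y q).
have sE A B : smooth_vfield A -> smooth_vfield B -> smooth_vfield (E A B).
  move=> sA sB; apply: smooth_vfieldB; apply: smooth_vfieldD; exact: conn_smooth.
have Esym A B q : smooth_vfield A -> smooth_vfield B -> E A B q = E B A q.
  move=> sA sB; apply/subr0_eq; rewrite /E.
  have t1 := tf A B sA sB q; have t2 := tf' A B sA sB q.
  have t3 := tf0 A B sA sB q; rewrite -{}t3 in t1 t2.
  move: (nabla A B q) (nabla' A B q) (nabla0 A B q) (nabla B A q) (nabla' B A q)
    (nabla0 B A q) t1 t2 => a a' a0 b b' b0 /eqP + /eqP.
  rewrite !subr_eq => /eqP-> /eqP->; apply/rowP => j; rewrite !mxE; ring.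
have Eskew A B C q : smooth_vfield A -> smooth_vfield B -> smooth_vfield C ->
    form2 g q (E A B q) (C q) = - form2 g q (E A C q) (B q).
  move=> sA sB sC.
  have d1 : lie_fun A (ev2 g B C) q
      = form2 g q (nabla A B q) (C q) + form2 g q (nabla' A C q) (B q).
    by rewrite du // /ev2 (Defs.metric_sym hg q (B q)).
  have d2 : lie_fun A (ev2 g B C) q
      = form2 g q (nabla A C q) (B q) + form2 g q (nabla' A B q) (C q).
    by rewrite ev2C // du // /ev2 (Defs.metric_sym hg q (C q)).
  have d0 : lie_fun A (ev2 g B C) q
      = form2 g q (nabla0 A B q) (C q) + form2 g q (nabla0 A C q) (B q).
    by rewrite du0 // /ev2 (Defs.metric_sym hg q (B q)).
  move: d1 d2 d0; rewrite /E !form2E.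
  move: (lie_fun _ _ _) (form2 _ _ (nabla A B q) _) (form2 _ _ (nabla' A B q) _)
    (form2 _ _ (nabla0 A B q) _) (form2 _ _ (nabla A C q) _)
    (form2 _ _ (nabla' A C q) _) (form2 _ _ (nabla0 A C q) _) => *; lra.
have H A B C q : smooth_vfield A -> smooth_vfield B -> smooth_vfield C ->
    form2 g q (E A B q) (C q) = 0.
  move=> sA sB sC.
  have e1 := Eskew A B C q sA sB sC; have e2 := Eskew B C A q sB sC sA.
  have e3 := Eskew C A B q sC sA sB.
  rewrite (Esym A C q sA sC) in e1; rewrite (Esym B A q sB sA) in e2.
  rewrite (Esym C B q sC sB) in e3; move: e1 e2 e3.
  move: (form2 _ _ _ _) (form2 _ _ _ _) (form2 _ _ _ _) => x y z; lra.
apply/subr0_eq/(metric_nondeg hg); exact: (H X Y (E X Y) p sX sY (sE _ _ sX sY)).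
Qed.

End Connections.

(** * Almost contact metric structures *)

Section AlmostContact.
Context {R : realType} {m : nat} {M : manifold R m}.
Variables (phi : M -> 'M[R]_m) (xi : M -> 'rV[R]_m) (eta : M -> 'cV[R]_m).
Variables (g : M -> 'M[R]_m).
Hypothesis hac : almost_contact_metric phi xi eta g.
Implicit Types (p : M) (v w : 'rV[R]_m).

Lemma form1E p v w a : form1 eta p (a *: v + w) = a * form1 eta p v + form1 eta p w.
Proof. by rewrite /form1 mulmxDl -scalemxAl !mxE. Qed.

(** Computing [phi^3 v] in two ways gives
    [eta(v) phi xi = eta(phi v) xi]; at [v = xi] this makes [phi xi] a multiple
    [c xi], and [phi^2 xi = 0] gives [c^2 = 0]. *)
Lemma contact_xi_phi p : xi p *m phi p = 0.
Proof.
have phi3 v : form1 eta p v *: (xi p *m phi p) = form1 eta p (v *m phi p) *: xi p.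
  have := ac_phi2 hac p (v *m phi p).
  rewrite (ac_phi2 hac p v) mulmxDl mulNmx -scalemxAl.
  exact: addrI.
have /[!ac_eta_xi hac] /[!scale1r] xiphi := phi3 (xi p).
set c := form1 _ _ _ in xiphi.
have : c * c = 0.
  have := ac_phi2 hac p (xi p).
  rewrite (ac_eta_xi hac) scale1r addNr xiphi -scalemxAl xiphi scalerA => cc.
  have := form1E p (xi p) 0 (c * c); rewrite addr0 cc (ac_eta_xi hac) mulr1.
  by rewrite /form1 mul0mx mxE addr0.
by move/eqP; rewrite mulf_eq0 orbb xiphi => /eqP->; rewrite scale0r.
Qed.

Lemma contact_eta p v : form1 eta p v = form2 g p v (xi p).
Proof.
have := ac_compat hac p v (xi p); rewrite contact_xi_phi form20r.
by rewrite (ac_eta_xi hac) mulr1 => /esym/subr0_eq.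
Qed.

Lemma contact_phi_perp p v : form2 g p (v *m phi p) (xi p) = 0.
Proof.
have := ac_phi2 hac p (v *m phi p).
rewrite (ac_phi2 hac p v) mulmxDl mulNmx -scalemxAl contact_xi_phi scaler0.
move/addrI/esym => E; rewrite -contact_eta.
have := form1E p (xi p) 0 (form1 eta p (v *m phi p)); rewrite addr0 E.
by rewrite (ac_eta_xi hac) mulr1 /form1 mul0mx mxE addr0.
Qed.

Lemma contact_phi2 p v :
  v *m phi p *m phi p = - v + form2 g p v (xi p) *: xi p.
Proof. by rewrite -contact_eta (ac_phi2 hac). Qed.

Lemma contact_phi2_perp p v : form2 g p v (xi p) = 0 ->
  v *m phi p *m phi p = - v.
Proof. by rewrite contact_phi2 => ->; rewrite scale0r addr0. Qed.

Lemma contact_phi_skew p v w :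
  form2 g p (v *m phi p) w = - form2 g p v (w *m phi p).
Proof.
have := ac_compat hac p (v *m phi p) w.
rewrite (contact_eta p (v *m phi p)) contact_phi_perp mul0r subr0 => <-.
rewrite contact_phi2 !form2E (Defs.metric_sym (ac_metric hac) p (xi p)).
by rewrite contact_phi_perp mulr0 addr0.
Qed.

End AlmostContact.

(** * Almost cosymplectic structures *)

Section AlmostCosymplectic.
Context {R : realType} {m : nat} {M : manifold R m}.
Variables (phi : M -> 'M[R]_m) (xi : M -> 'rV[R]_m) (eta : M -> 'cV[R]_m).
Variables (g : M -> 'M[R]_m).
Variable nabla0 : (M -> 'rV[R]_m) -> (M -> 'rV[R]_m) -> (M -> 'rV[R]_m).
Hypothesis hcs : almost_cosymplectic phi xi eta g.
Hypothesis h0 : levi_civita g nabla0.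
Implicit Types (X Y Z : M -> 'rV[R]_m) (p : M).

Let hac := acs_contact hcs.
Let hg : riemannian_metric g := ac_metric hac.
Let sxi : smooth_vfield xi := ac_xi hac.
Let cn0 : affine_connection nabla0 := lc_connection h0.
Let tf0 : torsion_free nabla0 := lc_torsion_free h0.
Let gC := Defs.metric_sym hg.

Local Notation D := (nabla0 xi).
Local Notation F := (endo_app phi).
Local Notation A0 := (shape_op nabla0 xi).

(** The fields tested against may be global: the difference of [V] and [W] is one. *)
Lemma eq_of_metric V W p : smooth_vfield V -> smooth_vfield W ->
  (forall Z, smooth_vfield Z -> form2 g p (V p) (Z p) = form2 g p (W p) (Z p)) ->
  V p = W p.
Proof.
move=> sV sW H; apply/subr0_eq/(metric_nondeg (p := p) hg).
have /= E := H _ (smooth_vfieldB sV sW).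
by rewrite form2Dl form2Nl E subrr.
Qed.

Lemma smooth_nabla_xi X : smooth_vfield X -> smooth_vfield (D X).
Proof. exact: (conn_smooth cn0). Qed.

Lemma smooth_phi X : smooth_vfield X -> smooth_vfield (F X).
Proof. exact/smooth_endo_app/(ac_phi hac). Qed.

Lemma smooth_shape nabla X : affine_connection nabla -> smooth_vfield X ->
  smooth_vfield (shape_op nabla xi X).
Proof. by move=> cn sX; apply: smooth_vfieldN; exact: (conn_smooth cn). Qed.

Let sA0 X : smooth_vfield X -> smooth_vfield (A0 X).
Proof. exact: smooth_shape. Qed.

Lemma D_metric X Y p : smooth_vfield X -> smooth_vfield Y ->
  lie_fun xi (ev2 g X Y) p = form2 g p (D X p) (Y p) + form2 g p (X p) (D Y p).
Proof. by move=> sX sY; rewrite (lc_metric h0). Qed.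

Lemma lie_fun_cst X (k : R) p : lie_fun X (fun=> k) p = 0.
Proof. by rewrite /lie_fun /dmap; exact: derive_cst. Qed.

(** This is [d eta (X, Y) = 0], as [eta] is dual to [xi]. *)
Lemma A0_sym X Y p : smooth_vfield X -> smooth_vfield Y ->
  form2 g p (A0 X p) (Y p) = form2 g p (X p) (A0 Y p).
Proof.
move=> sX sY; have := acs_d_eta hcs sX sY p; rewrite /d1.
have eE Z : ev1 eta Z = ev2 g Z xi.
  by apply/funext => q; exact: (contact_eta hac).
rewrite !eE !(lc_metric h0) // /ev2 -(tf0 sX sY) /shape_op !form2E.
rewrite (gC p _ (nabla0 X xi p)).
move: (form2 _ _ _ _) (form2 _ _ (nabla0 X xi p) _) => *; lra.
Qed.

(** By symmetry, [g (nabla0_xi xi, Y)] is half the derivative of [g(xi, xi) = 1]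
    along [Y]. *)
Lemma D_xi : D xi = fun=> 0.
Proof.
apply/funext => p; apply: (metric_nondeg (p := p) hg).
have sD := smooth_nabla_xi sxi.
have := A0_sym p sxi sD; rewrite /shape_op !form2E => /oppr_inj ->.
have : lie_fun (D xi) (ev2 g xi xi) p = 0.
  rewrite (_ : ev2 g xi xi = fun=> 1); first exact: lie_fun_cst.
  by apply/funext => q; rewrite /ev2 -(contact_eta hac) (ac_eta_xi hac).
rewrite (lc_metric h0) // /ev2 (gC p (nabla0 _ _ _)).
move: (form2 _ _ _ _) => x; lra.
Qed.

Lemma A0_xi : A0 xi = fun=> 0.
Proof. by apply/funext => p; rewrite /shape_op D_xi oppr0. Qed.

Lemma A0_perp X p : smooth_vfield X -> form2 g p (A0 X p) (xi p) = 0.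
Proof. by move=> sX; rewrite A0_sym // A0_xi form20r. Qed.

Lemma D_perp X p : smooth_vfield X ->
  (forall q, form2 g q (X q) (xi q) = 0) -> form2 g p (D X p) (xi p) = 0.
Proof.
move=> sX X0; have := D_metric p sX sxi; rewrite D_xi form20r addr0 => <-.
rewrite (_ : ev2 g X xi = fun=> 0); first exact: lie_fun_cst.
exact/funext.
Qed.

(** This is [dPhi(xi, Y, Z) = 0]. *)
Lemma D_phi_commutator Y p : smooth_vfield Y ->
  D (F Y) p - F (D Y) p = F (A0 Y) p + A0 (F Y) p.
Proof.
move=> sY.
have [[sFY sDY] sAY] := (smooth_phi sY, smooth_nabla_xi sY, sA0 sY).
pose V q := D (F Y) q - F (D Y) q; pose W q := F (A0 Y) q + A0 (F Y) q.
suff : V p = W p by [].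
apply: eq_of_metric.
- by apply: smooth_vfieldB; [exact: smooth_nabla_xi|exact: smooth_phi].
- by apply: smooth_vfieldD; [exact: smooth_phi|exact: sA0].
move=> Z sZ; rewrite {}/V {}/W.
have Phixi W : ev2 g (F xi) W = fun=> 0.
  by apply/funext => q; rewrite /ev2 /endo_app (contact_xi_phi hac) form20l.
have Phixir W q : ev2 g (F W) xi q = 0 by exact: (contact_phi_perp hac).
have : form2 g p (A0 (F Y) p) (Z p) = - form2 g p (A0 Z p *m phi p) (Y p).
  by rewrite (A0_sym p sFY sZ) gC (contact_phi_skew hac p (A0 Z p)) opprK.
move: (acs_d_Phi hcs sxi sY sZ p); rewrite /d2 /fundamental_form.
have l0 V W : lie_fun V (ev2 g (F xi) W) p = 0.
  by rewrite Phixi; exact: lie_fun_cst.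
have := D_metric p sFY sZ.
rewrite (torsion_free_bracket tf0 sxi sY) (torsion_free_bracket tf0 sxi sZ).
move: (l0 Y Z) (l0 Z Y) (Phixir (bracket Y Z) p).
rewrite {1 2 4}/ev2.
move: (lie_fun Y _ p) (lie_fun Z _ p) (lie_fun xi _ p).
move=> a b c -> -> -> -> /=.
rewrite /ev2 /endo_app /=.
rewrite /shape_op !mulmxDl !mulNmx !form2E.
rewrite (contact_phi_skew hac p (nabla0 xi Z p)) (gC p (nabla0 xi Z p)).
move=> *; lra.
Qed.

(** [phi^2] differs from [- Id] by a multiple of [xi], and [A0 xi = 0].  Moving
    [A0] to the test field avoids any use of linearity over functions. *)
Lemma A0_phi2 X p : smooth_vfield X -> A0 (F (F X)) p = - A0 X p.
Proof.
move=> sX; have sF2 := smooth_phi (smooth_phi sX).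
apply: (@eq_of_metric _ (fun q => - A0 X q)).
- exact: sA0.
- exact/smooth_vfieldN/sA0.
move=> Z sZ; rewrite (A0_sym p sF2 sZ) {1}/endo_app /endo_app.
rewrite (contact_phi2 hac) form2Dl form2Zl form2Nl form2Nl.
rewrite (gC p (xi p)) (A0_perp p sZ) mulr0 addr0.
by rewrite (A0_sym p sX sZ).
Qed.

Lemma D_phi_A0_phi X : smooth_vfield X ->
  D (F X) = F (D X) /\ A0 (F X) = fun p => - F (A0 X) p.
Proof.
(* Both the commutator of D with phi and the anticommutator of A0 with phi are
   the operator Q, which therefore satisfies Q phi = phi Q, and the commutator
   of D with phi^3 = - phi is 3 phi^2 Q = - 3 Q, so that Q = 0. *)
pose Q Y p := F (A0 Y) p + A0 (F Y) p.
have DQ Y p : smooth_vfield Y -> D (F Y) p = D Y p *m phi p + Q Y p.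
  by move=> sY; rewrite /Q -(D_phi_commutator p sY) addrC subrK.
have QF Y p : smooth_vfield Y -> Q (F Y) p = Q Y p *m phi p.
  move=> sY; rewrite /Q (A0_phi2 p sY) mulmxDl addrC; congr (_ + _).
  by rewrite -(contact_phi2_perp hac (A0_perp p sY)).
have Qphi2 Y p : smooth_vfield Y -> Q Y p *m phi p *m phi p = - Q Y p.
  move=> sY; apply: (contact_phi2_perp hac); rewrite /Q form2Dl.
  by rewrite (contact_phi_perp hac) (A0_perp p (smooth_phi sY)) addr0.
have QE Y p : Q Y p = F (A0 Y) p + A0 (F Y) p by [].
clearbody Q; have phi3 Y p : Y p *m phi p *m phi p *m phi p = - (Y p *m phi p).
  by rewrite (contact_phi2_perp hac (contact_phi_perp hac p (Y p))).
have Q0 Y p : smooth_vfield Y -> Q Y p = 0.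
  move=> sY; have sF1 := smooth_phi sY; have sF2 := smooth_phi sF1.
  have E1 : D (F (F (F Y))) p = - D (F Y) p.
    rewrite -(connNr cn0 p sxi sF1); congr (D _ p).
    by apply/funext => q; exact: phi3.
  have := DQ _ p sF2; rewrite E1 (QF _ p sF1) (QF _ p sY) (Qphi2 _ p sY).
  rewrite (DQ _ p sF1) (QF _ p sY) mulmxDl (Qphi2 _ p sY).
  rewrite (DQ _ p sY) !mulmxDl (Qphi2 _ p sY) phi3.
  move: (D Y p *m phi p) (Q Y p) => a q /eqP; rewrite -subr_eq0 => /eqP E.
  apply/rowP => j; move/rowP/(_ j) : E; rewrite !mxE => E; lra.
move=> sX; split; apply/funext => p; first by rewrite DQ // Q0 // addr0.
by apply/eqP; rewrite -subr_eq0 opprK addrC -QE Q0.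
Qed.

End AlmostCosymplectic.

(** * Operators with an adjoint and their traces *)

Section Traces.
Context {R : realType} {m : nat} {M : manifold R m}.
Variables (g : M -> 'M[R]_m) (hg : riemannian_metric g).
Implicit Types (X Y Z : M -> 'rV[R]_m) (p : M).
Implicit Types T U : (M -> 'rV[R]_m) -> (M -> 'rV[R]_m).

Lemma form2_suml p I (r : seq I) (f : I -> 'rV[R]_m) w :
  form2 g p (\sum_(i <- r) f i) w = \sum_(i <- r) form2 g p (f i) w.
Proof.
elim: r => [|i r IH]; first by rewrite !big_nil form20l.
by rewrite !big_cons form2Dl IH.
Qed.

(** [T'] is an adjoint of [T] on smooth vector fields, pointwise for the metric. *)
Definition adjoint_op T T' : Prop :=
  [/\ (forall X, smooth_vfield X -> smooth_vfield (T X)),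
      (forall X, smooth_vfield X -> smooth_vfield (T' X)) &
      forall X Y p, smooth_vfield X -> smooth_vfield Y ->
        form2 g p (T X p) (Y p) = form2 g p (X p) (T' Y p)].

Lemma adjoint_opD T T' U U' : adjoint_op T T' -> adjoint_op U U' ->
  adjoint_op (fun X p => T X p + U X p) (fun X p => T' X p + U' X p).
Proof.
move=> [sT sT' TT] [sU sU' UU]; split=> [X sX|X sX|X Y p sX sY].
- by apply: smooth_vfieldD; [exact: sT|exact: sU].
- by apply: smooth_vfieldD; [exact: sT'|exact: sU'].
- by rewrite form2Dl form2Dr TT // UU.
Qed.

Lemma adjoint_opN T T' : adjoint_op T T' ->
  adjoint_op (fun X p => - T X p) (fun X p => - T' X p).
Proof.
move=> [sT sT' TT]; split=> [X sX|X sX|X Y p sX sY].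
- exact/smooth_vfieldN/sT.
- exact/smooth_vfieldN/sT'.
- by rewrite form2Nl form2Nr TT.
Qed.

Lemma adjoint_opM T T' U U' : adjoint_op T T' -> adjoint_op U U' ->
  adjoint_op (T \o U) (U' \o T').
Proof.
move=> [sT sT' TT] [sU sU' UU]; split=> [X sX|X sX|X Y p sX sY] /=.
- exact/sT/sU.
- exact/sU'/sT'.
- by rewrite (TT (U X) Y p (sU _ sX) sY) (UU X (T' Y) p sX (sT' _ sY)).
Qed.

(** An operator with an adjoint is tensorial: [g (T X, Z) = g (X, T' Z)] depends
    on [X] only through its value at the point, and determines [T X] there since
    [Z] can take any value.  No linearity of [T] is assumed. *)
Lemma adjoint_op_matrix T T' p : adjoint_op T T' ->
  exists L : 'M[R]_m, forall X, smooth_vfield X -> T X p = X p *m L.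
Proof.
move=> [sT sT' TT].
have /choice[E /all_and2[sE Ep]] (i : 'I_m) :
    exists X : M -> 'rV[R]_m, smooth_vfield X /\ X p = delta_mx 0 i.
  by have [X sX Xp] := smooth_vfield_through p (delta_mx 0 i); exists X.
exists (\matrix_(i < m) T (E i) p) => X sX.
apply/subr0_eq/(metric_nondeg (p := p) hg); set v := _ - _.
have [Z sZ Zp] := smooth_vfield_through p v.
rewrite -{2}Zp /v form2Dl form2Nl (TT X Z p sX sZ) mulmx_sum_row form2_suml.
rewrite (eq_bigr (fun i => form2 g p (X p 0 i *: delta_mx 0 i) (T' Z p))).
  by rewrite -form2_suml -row_sum_delta subrr.
by move=> i _; rewrite rowK !form2Zl (TT (E i) Z p (sE i) sZ) Ep.
Qed.

Lemma trace_atE p T (L : 'M[R]_m) :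
  (forall X, smooth_vfield X -> T X p = X p *m L) -> trace_at p T = \tr L.
Proof.
move=> TL; rewrite /trace_at; congr (\tr _).
apply: xget_unique => // L' TL'; apply/row_matrixP => i.
have [X sX Xp] := smooth_vfield_through p (delta_mx 0 i).
by rewrite !rowE -Xp -TL // TL'.
Qed.

End Traces.

(** * Curvature of the statistical connections along xi *)

Section Statistical.
Context {R : realType} {m : nat} {M : manifold R m}.
Variables (phi : M -> 'M[R]_m) (xi : M -> 'rV[R]_m) (eta : M -> 'cV[R]_m).
Variables (g : M -> 'M[R]_m).
Variables nabla nabla' nabla0 :
  (M -> 'rV[R]_m) -> (M -> 'rV[R]_m) -> (M -> 'rV[R]_m).
Hypothesis hcs : almost_cosymplectic phi xi eta g.
Hypothesis h0 : levi_civita g nabla0.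
Implicit Types (X Y Z : M -> 'rV[R]_m) (p : M).

Let hac := acs_contact hcs.
Let hg : riemannian_metric g := ac_metric hac.
Let sxi : smooth_vfield xi := ac_xi hac.
Let cn0 : affine_connection nabla0 := lc_connection h0.
Let tf0 : torsion_free nabla0 := lc_torsion_free h0.

Local Notation D := (nabla0 xi).
Local Notation F := (endo_app phi).
Local Notation A0 := (shape_op nabla0 xi).

Let sD X : smooth_vfield X -> smooth_vfield (D X) := smooth_nabla_xi hcs h0 (X:=X).
Let sF X : smooth_vfield X -> smooth_vfield (F X) := smooth_phi hcs (X:=X).
Let sA0 X : smooth_vfield X -> smooth_vfield (A0 X) :=
  smooth_shape hcs cn0 (X:=X).

(** Although [D] is a derivation and has no adjoint, [[D, T]] has the adjoint
    [[D, T']], because [D] preserves the metric. *)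
Lemma adjoint_op_commutator T T' : adjoint_op g T T' ->
  adjoint_op g (fun X p => D (T X) p - T (D X) p)
               (fun X p => D (T' X) p - T' (D X) p).
Proof.
move=> [sT sT' TT]; split=> [X sX|X sX|X Y p sX sY].
- by apply: smooth_vfieldB; [exact/sD/sT|exact/sT/sD].
- by apply: smooth_vfieldB; [exact/sD/sT'|exact/sT'/sD].
have TXY : ev2 g (T X) Y = ev2 g X (T' Y).
  by apply/funext => q; exact: TT.
have := D_metric hcs h0 p (sT _ sX) sY; rewrite TXY.
rewrite (D_metric hcs h0 p sX (sT' _ sY)) (TT X (D Y) p sX (sD sY)).
rewrite !form2E (TT (D X) Y p (sD sX) sY).
move: (form2 _ _ (D X p) _) (form2 _ _ (D (T X) p) _) (form2 _ _ _ (D (T' Y) p)).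
move: (form2 _ _ _ _) => *; lra.
Qed.

(** Here [K] is any operator such that [nab_xi = D + K] and [- nab xi = A0 - K];
    it is the difference tensor along [xi] for one of the two connections and its
    opposite for the other. *)
Lemma curvature_xi_xi nab (K : (M -> 'rV[R]_m) -> (M -> 'rV[R]_m)) X p :
  affine_connection nab ->
  (forall Y, smooth_vfield Y -> smooth_vfield (K Y)) ->
  (forall Y q, smooth_vfield Y -> nab xi Y q = D Y q + K Y q) ->
  (forall Y q, smooth_vfield Y -> nab Y xi q = - A0 Y q + K Y q) ->
  nab xi xi = (fun=> 0) -> smooth_vfield X ->
  curvature nab X xi xi p =
    (D (A0 X) p - A0 (D X) p) - (D (K X) p - K (D X) p)
    + (K (A0 X) p + K (A0 X) p) - K (K X) p - A0 (A0 X) p.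
Proof.
move=> cn sK nE sE nxi sX; rewrite /curvature nxi (conn0r cn sX).
have [sAX sKX sDX] := And3 (sA0 sX) (sK _ sX) (sD sX).
have -> : nab X xi = fun q => K X q - A0 X q.
  by apply/funext => q; rewrite sE // addrC.
rewrite (connBr cn p sxi sKX sAX) !nE //.
rewrite (torsion_free_bracket tf0 sX sxi).
have -> : nab (fun q => nabla0 X xi q - D X q) xi p = - nab (A0 X) xi p - nab (D X) xi p.
  rewrite -(connNl cn p sAX sxi) -(connBl cn p (smooth_vfieldN sAX) sDX sxi).
  by congr (nab _ xi p); apply/funext => q; rewrite /shape_op opprK.
rewrite !sE //.
move: (D (K X) p) (K (K X) p) (D (A0 X) p) (K (A0 X) p) (A0 (A0 X) p).
move: (A0 (D X) p) (K (D X) p) => *; apply/rowP => j; rewrite !mxE; ring.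
Qed.

Hypothesis hst : statistical_structure g nabla nabla'.
Hypothesis hK : forall X, smooth_vfield X ->
  forall p, difference_act nabla nabla0 xi phi X p = 0.
Hypothesis hA : forall p, shape_op nabla xi xi p = 0.

Local Notation K := (difference nabla nabla0 xi).
Let cn := stat_connection hst.
Let cn' := stat_connection' hst.

Lemma smooth_difference_xi X : smooth_vfield X -> smooth_vfield (K X).
Proof.
move=> sX; apply: smooth_vfieldB; [exact: (conn_smooth cn)|exact: (conn_smooth cn0)].
Qed.

Lemma nabla_xiE X p : nabla xi X p = D X p + K X p.
Proof. by rewrite /difference addrC subrK. Qed.

Lemma nabla'_xiE X p : smooth_vfield X -> nabla' xi X p = D X p - K X p.
Proof.
move=> sX; have := statistical_mean p hst h0 sxi sX; rewrite nabla_xiE.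
move: (D X p) (K X p) (nabla' xi X p) => d k n' E.
by apply/rowP => j; move/rowP/(_ j) : E; rewrite !mxE; lra.
Qed.

Lemma nabla_xi X p : smooth_vfield X -> nabla X xi p = - A0 X p + K X p.
Proof.
move=> sX; have := stat_torsion_free hst sX sxi p.
rewrite -(tf0 sX sxi) nabla_xiE /shape_op opprK.
move: (nabla X xi p) (nabla0 X xi p) (D X p) (K X p) => a b c d /eqP.
by rewrite subr_eq addrA subrK => /eqP.
Qed.

Lemma nabla'_xi X p : smooth_vfield X -> nabla' X xi p = - A0 X p - K X p.
Proof.
move=> sX; have := stat_torsion_free' hst sX sxi p.
rewrite -(tf0 sX sxi) nabla'_xiE // /shape_op opprK.
move: (nabla' X xi p) (nabla0 X xi p) (D X p) (K X p) => a b c d /eqP.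
by rewrite subr_eq addrA subrK => /eqP.
Qed.

Lemma K_sym X Y p : smooth_vfield X -> smooth_vfield Y ->
  form2 g p (K X p) (Y p) = form2 g p (X p) (K Y p).
Proof.
move=> sX sY; have := stat_dual hst sX sY sxi p; rewrite (D_metric hcs h0) //.
rewrite /ev2 nabla_xiE nabla'_xiE // form2Dl form2Dr form2Nr.
move: (form2 _ _ (D X p) _) (form2 _ _ _ (D Y p)) (form2 _ _ (K X p) _).
move: (form2 _ _ _ _) => *; lra.
Qed.

Lemma nabla_xi_xi : nabla xi xi = fun=> 0.
Proof.
by apply/funext => p; have /eqP := hA p; rewrite /shape_op oppr_eq0 => /eqP.
Qed.

Lemma K_xi p : K xi p = 0.
Proof. by rewrite /difference nabla_xi_xi (D_xi hcs h0) subr0. Qed.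

Lemma K_phi X : smooth_vfield X -> K (F X) = F (K X).
Proof. by move=> sX; apply/funext => p; apply/subr0_eq; exact: hK. Qed.

Lemma K_perp X p : smooth_vfield X -> form2 g p (K X p) (xi p) = 0.
Proof. by move=> sX; rewrite K_sym // K_xi form20r. Qed.

Lemma KN X p : smooth_vfield X -> K (fun q => - X q) p = - K X p.
Proof.
by move=> sX; rewrite /difference (connNr cn) // (connNr cn0) // opprB opprK addrC.
Qed.

Lemma KB X Y p : smooth_vfield X -> smooth_vfield Y ->
  K (fun q => X q - Y q) p = K X p - K Y p.
Proof.
move=> sX sY; rewrite /difference (connBr cn p sxi sX sY) (connBr cn0 p sxi sX sY).
move: (nabla xi X p) (D X p) (nabla xi Y p) (D Y p) => *.
by apply/rowP => j; rewrite !mxE; ring.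
Qed.

Lemma A0B X Y p : smooth_vfield X -> smooth_vfield Y ->
  A0 (fun q => X q - Y q) p = A0 X p - A0 Y p.
Proof.
by move=> sX sY; rewrite /shape_op (connBl cn0 p sX sY sxi) opprD.
Qed.

Lemma shape_opE X : smooth_vfield X -> shape_op nabla xi X = fun p => A0 X p - K X p.
Proof.
by move=> sX; apply/funext => p; rewrite {1}/shape_op nabla_xi // opprD opprK.
Qed.

Lemma shape_op'E X : smooth_vfield X ->
  shape_op nabla' xi X = fun p => A0 X p - - K X p.
Proof.
by move=> sX; apply/funext => p; rewrite {1}/shape_op nabla'_xi // opprD opprK.
Qed.

Lemma shape_op2_sum X p : smooth_vfield X ->
  shape_op nabla xi (shape_op nabla xi X) p
    + shape_op nabla' xi (shape_op nabla' xi X) p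
  = 2 *: (A0 (A0 X) p + K (K X) p).
Proof.
move=> sX; have [sAX sKX] := (sA0 sX, smooth_difference_xi sX).
have sNKX := smooth_vfieldN sKX.
rewrite (shape_opE sX) (shape_op'E sX).
rewrite (shape_opE (smooth_vfieldB sAX sKX)).
rewrite (shape_op'E (smooth_vfieldB sAX sNKX)).
rewrite (A0B p sAX sKX) (A0B p sAX sNKX) (KB p sAX sKX) (KB p sAX sNKX).
rewrite (KN p sKX).
have -> : A0 (fun q => - K X q) p = - A0 (K X) p.
  by rewrite /shape_op (connNl cn0 p sKX sxi).
move: (A0 (A0 X) p) (K (K X) p) (A0 (K X) p) (K (A0 X) p) => *.
apply/rowP => j; rewrite !mxE; ring.
Qed.

Lemma curvature_nabla X p : smooth_vfield X ->
  curvature nabla X xi xi p =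
    (D (A0 X) p - A0 (D X) p) - (D (K X) p - K (D X) p)
    + (K (A0 X) p + K (A0 X) p) - K (K X) p - A0 (A0 X) p.
Proof.
move=> sX; apply: (curvature_xi_xi p cn smooth_difference_xi _ nabla_xi nabla_xi_xi sX).
by move=> Y q _; exact: nabla_xiE.
Qed.

Lemma curvature_nabla' X p : smooth_vfield X ->
  curvature nabla' X xi xi p =
    (D (A0 X) p - A0 (D X) p) + (D (K X) p - K (D X) p)
    - (K (A0 X) p + K (A0 X) p) - K (K X) p - A0 (A0 X) p.
Proof.
move=> sX; have sKX := smooth_difference_xi sX.
have sK' Y : smooth_vfield Y -> smooth_vfield (fun q => - K Y q).
  by move=> sY; exact/smooth_vfieldN/smooth_difference_xi.
have nxi : nabla' xi xi = fun=> 0.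
  by apply/funext => q; rewrite (nabla'_xiE q sxi) K_xi (D_xi hcs h0) subr0.
rewrite (curvature_xi_xi p cn' sK' nabla'_xiE nabla'_xi nxi sX).
rewrite (connNr cn0 p sxi sKX) (KN p sKX).
move: (D (K X) p) (K (K X) p) (D (A0 X) p) (K (A0 X) p) (A0 (A0 X) p).
by move: (A0 (D X) p) (K (D X) p) => *; apply/rowP => j; rewrite !mxE; ring.
Qed.

(** Half of the sum of the two operators [X |-> R(X, xi) xi]. *)
Definition mean_jacobi X p :=
  D (A0 X) p - A0 (D X) p - (A0 (A0 X) p + K (K X) p).
Local Notation Q := mean_jacobi.

Lemma curvature_sum X p : smooth_vfield X ->
  curvature nabla X xi xi p + curvature nabla' X xi xi p = 2 *: Q X p.
Proof.
move=> sX; rewrite curvature_nabla // curvature_nabla' // /Q.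
move: (D (K X) p) (K (K X) p) (D (A0 X) p) (K (A0 X) p) (A0 (A0 X) p).
move: (A0 (D X) p) (K (D X) p) => *; apply/rowP => j; rewrite !mxE; ring.
Qed.

(** Conjugation by [phi] fixes [[D, A0]] and changes the sign of [A0^2 + K^2]. *)
Lemma mean_jacobi_phi X p : smooth_vfield X ->
  Q X p - Q (F X) p *m phi p = - 2 *: (A0 (A0 X) p + K (K X) p).
Proof.
move=> sX; have [sFX sDX] := (sF sX, sD sX).
have [sAX sKX] := (sA0 sX, smooth_difference_xi sX).
have [_ A0F] := D_phi_A0_phi hcs h0 sX.
have [DF _] := D_phi_A0_phi hcs h0 sX.
have [DFA A0FA] := D_phi_A0_phi hcs h0 sAX.
have [_ A0FD] := D_phi_A0_phi hcs h0 sDX.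
have sFAX := sF sAX.
rewrite {2}/Q A0F DF A0FD (K_phi sX) (K_phi sKX).
rewrite (connNr cn0 p sxi sFAX) DFA.
have -> : A0 (fun q => - F (A0 X) q) p = F (A0 (A0 X)) p.
  rewrite -[RHS]opprK -[- F _ p]/((fun q => - F (A0 (A0 X)) q) p) -A0FA.
  by rewrite /shape_op (connNl cn0 p sFAX sxi).
rewrite !mulmxDl !mulNmx mulmxDl /endo_app.
have perp V : form2 g p (V p) (xi p) = 0 -> V p *m phi p *m phi p = - V p.
  exact: (contact_phi2_perp hac).
rewrite (perp (D (A0 X))); last first.
  by apply: (D_perp hcs h0) => // q; exact: (A0_perp hcs h0).
rewrite (perp (A0 (D X))) ?(A0_perp hcs h0) //.
rewrite (perp (A0 (A0 X))) ?(A0_perp hcs h0) //.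
rewrite (perp (K (K X))) ?K_perp // /Q.
move: (D (A0 X) p) (A0 (D X) p) (A0 (A0 X) p) (K (K X) p) => *.
apply/rowP => j; rewrite !mxE; ring.
Qed.

Lemma curvature_phi_identity X p : smooth_vfield X ->
  curvature nabla X xi xi p - endo_app phi (curvature nabla (F X) xi xi) p
  + curvature nabla' X xi xi p - endo_app phi (curvature nabla' (F X) xi xi) p
  = - 2 *: (shape_op nabla xi (shape_op nabla xi X) p
    + shape_op nabla' xi (shape_op nabla' xi X) p).
Proof.
move=> sX; rewrite shape_op2_sum //.
have S := curvature_sum p sX; have S' := curvature_sum p (sF sX).
transitivity (2 *: Q X p - 2 *: Q (F X) p *m phi p).
  rewrite -S -S' mulmxDl.
  set c := curvature nabla (F X) xi xi; set c' := curvature nabla' (F X) xi xi.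
  rewrite /endo_app.
  move: (curvature _ X _ _ p) (curvature nabla' X _ _ p).
  move: (c p *m _) (c' p *m _) => *.
  by apply/rowP => j; rewrite !mxE; ring.
by rewrite -scalemxAl -scalerBr mean_jacobi_phi // !scalerA mulrC.
Qed.

Lemma adjoint_op_K : adjoint_op g K K.
Proof.
by split; [exact: smooth_difference_xi..|move=> *; exact: K_sym].
Qed.

Lemma adjoint_op_A0 : adjoint_op g A0 A0.
Proof. split; [exact: sA0|exact: sA0|by move=> *; exact: (A0_sym hcs h0)]. Qed.

Lemma curvature_xi_diag nab p : affine_connection nab -> curvature nab xi xi xi p = 0.
Proof.
move=> cnab; rewrite /curvature subrr sub0r; apply/eqP; rewrite oppr_eq0.
have -> : bracket xi xi = fun q => xi q - xi q.
  by apply/funext => q; rewrite /bracket !subrr.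
by rewrite (connBl cnab p sxi sxi sxi) subrr.
Qed.

Lemma eq_of_mulrow n (B C : 'M[R]_(m, n)) :
  (forall v : 'rV[R]_m, v *m B = v *m C) -> B = C.
Proof. by move=> BC; apply/row_matrixP => i; rewrite !rowE. Qed.

Lemma ricci_sum p :
  ricci nabla xi xi p + ricci nabla' xi xi p
  = - trace_at p (fun X => shape_op nabla xi (shape_op nabla xi X)
                           \+ shape_op nabla' xi (shape_op nabla' xi X)).
Proof.
have aA := adjoint_op_A0; have aK := adjoint_op_K.
have cA := adjoint_op_commutator aA; have cK := adjoint_op_commutator aK.
have aKA := adjoint_opM aK aA; have a2KA := adjoint_opD aKA aKA.
have aKK := adjoint_opN (adjoint_opM aK aK).
have aAA := adjoint_opN (adjoint_opM aA aA).
have [L1 H1] := adjoint_op_matrix hg p (adjoint_opD (adjoint_opD (adjoint_opD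
  (adjoint_opD cA (adjoint_opN cK)) a2KA) aKK) aAA).
have [L2 H2] := adjoint_op_matrix hg p (adjoint_opD (adjoint_opD (adjoint_opD
  (adjoint_opD cA cK) (adjoint_opN a2KA)) aKK) aAA).
have [L3 H3] := adjoint_op_matrix hg p (adjoint_opD aAA aKK).
have R1 X : smooth_vfield X -> curvature nabla X xi xi p = X p *m L1.
  by move=> sX; rewrite curvature_nabla //; exact: (H1 X sX).
have R2 X : smooth_vfield X -> curvature nabla' X xi xi p = X p *m L2.
  by move=> sX; rewrite curvature_nabla' //; exact: (H2 X sX).
have R3 X : smooth_vfield X -> shape_op nabla xi (shape_op nabla xi X) p
    + shape_op nabla' xi (shape_op nabla' xi X) p = X p *m (- 2 *: L3).
  move=> sX; rewrite shape_op2_sum // -scalemxAr -(H3 X sX) /= -opprD.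
  by rewrite scaleNr scalerN opprK.
rewrite /ricci (trace_atE R1) (trace_atE R2) (trace_atE R3) -mxtraceD.
set L := L1 + L2.
have xiL : xi p *m L = 0.
  by rewrite mulmxDr -R1 // -R2 // !curvature_xi_diag // addr0.
(* [phi^2 = - Id + eta (x) xi] and the row vector [xi L] is 0. *)
have phi2L : phi p *m phi p *m L = - L.
  apply: eq_of_mulrow => v; rewrite !mulmxA (ac_phi2 hac) mulmxDl -scalemxAl xiL.
  by rewrite scaler0 addr0 mulNmx mulmxN.
have E : L - phi p *m L *m phi p = - 2 *: (- 2 *: L3).
  apply: eq_of_mulrow => v; have [X sX Xp] := smooth_vfield_through p v.
  have := curvature_phi_identity p sX.
  have F1 : F (curvature nabla (F X) xi xi) p = X p *m phi p *m L1 *m phi p.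
    by rewrite -[X p *m phi p]/(F X p) -(R1 _ (sF sX)).
  have F2 : F (curvature nabla' (F X) xi xi) p = X p *m phi p *m L2 *m phi p.
    by rewrite -[X p *m phi p]/(F X p) -(R2 _ (sF sX)).
  rewrite R3 // (R1 X sX) (R2 X sX) F1 F2 Xp [_ *: (_ *m _)]scalemxAr => <-.
  rewrite /L mulmxBr !mulmxA !mulmxDr !mulmxDl.
  move: (v *m L1) (v *m L2) (_ *m phi p) (_ *m phi p) => *.
  by apply/rowP => j; rewrite !mxE; ring.
have := congr1 mxtrace E; rewrite mxtraceD raddfN /= mxtrace_mulC mulmxA phi2L.
rewrite raddfN /= opprK mxtraceZ.
move: (\tr L) (\tr (_ *: L3)) => x y; lra.
Qed.

End Statistical.

Theorem theorem9 (R : realType) (n : nat) (M : manifold R (2 * n).+1)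
  (phi : M -> 'M[R]_((2 * n).+1)) (xi : M -> 'rV[R]_((2 * n).+1))
  (eta : M -> 'cV[R]_((2 * n).+1)) (g : M -> 'M[R]_((2 * n).+1))
  (nabla nabla' nabla0 : (M -> 'rV[R]_((2 * n).+1)) ->
     (M -> 'rV[R]_((2 * n).+1)) -> (M -> 'rV[R]_((2 * n).+1)))
  (hM : almost_cosymplectic_statistical phi xi eta g nabla nabla')
  (h0 : levi_civita g nabla0)
  (hK : forall X, smooth_vfield X ->
     forall p, difference_act nabla nabla0 xi phi X p = 0)
  (hA : forall p, shape_op nabla xi xi p = 0) :
  let A := shape_op nabla xi in
  let A' := shape_op nabla' xi in
  (forall X, smooth_vfield X -> forall p,
     curvature nabla X xi xi p
     - endo_app phi (curvature nabla (endo_app phi X) xi xi) p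
     + curvature nabla' X xi xi p
     - endo_app phi (curvature nabla' (endo_app phi X) xi xi) p
     = - 2 *: (A (A X) p + A' (A' X) p)) /\
  (forall p, ricci nabla xi xi p + ricci nabla' xi xi p
     = - trace_at p (fun X => A (A X) \+ A' (A' X))).
Proof.
case: hM => hcs hst; split=> [X sX p|p].
  exact: (curvature_phi_identity hcs h0 hst hK hA).
exact: (ricci_sum hcs h0 hst hK hA).
Qed.
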